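(* For all constants $k$ and $w$, State Reachability and Action Executability are solvable in polynomial time on instances whose initial task network $(T,\prec^+,\alpha)$ is primitive, has generalized partial order width at most $w$, and whose state transition graph has at most $k$ states.
   Context: An HTN domain is a tuple $D=(F,A,\mathcal{C},\delta,M)$ where $F$ is a finite set of propositions, $A$ a set of actions, $\mathcal{C}$ a set of compound task names disjoint from $A$, $\delta$ maps each action $a$ to $(\mathrm{pre}(a),\mathrm{del}(a),\mathrm{add}(a))$, subsets of $F$, and $M$ gives decomposition methods. Action $a$ is executable in state $s\subseteq F$ if $\mathrm{pre}(a)\subseteq s$; executing it yields $(s\setminus\mathrm{del}(a))\cup\mathrm{add}(a)$. A task network is $(T,\prec^+,\alpha)$ with $T$ finite, $\prec^+$ a strict partial order on $T$, $\alpha:T\to A\cup\mathcal{C}$; primitive if $\alpha(T)\subseteq A$. A linearization is a total order $\bar t$ of $T$ extending $\prec^+$, with action sequence $\alpha(\bar t)$. For a primitive initial network $tn=(T,\prec^+,\alpha)$, a solution to $(D,tn,s_0)$ is a primitive network $(T',\prec'^+,\alpha')$ with $T'\subseteq T$, $\alpha'=\alpha|_{T'}$, $T'$ downward closed under $\prec^+$, $\prec'^+$ containing the restriction of $\prec^+$ to $T'$, and having a linearization whose action sequence is executable from $s_0$. State Reachability: given $tn$, $s_0$ and a target state $s_g\subseteq F$, decide whether there is a solution with a linearization whose execution from $s_0$ yields a state $s\supseteq s_g$. Action Executability: given $tn$, $s_0$ and a multiset $S$ of actions, decide whether there is a solution with a linearization $\bar t$ such that $\alpha(\bar t)$ covers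 $S$ (each action occurs at least as often as in $S$). The state transition graph is the multigraph whose vertices are the states reachable from $s_0$ by any sequence of actions of $A$, with an arc labeled $a$ from $s$ to $s'$ whenever $a$ is executable in $s$ and yields $s'$. The partial order width is the size of the largest antichain; an element is isolated if incomparable to all others; the generalized partial order width is the partial order width after removing isolated elements. *)

(* Defs.v *)
From mathcomp Require Import all_boot.


(* Propositions are 0 .. nF-1, actions are the indices of [acts],     *)
(* each action is a triple (pre, del, add) of lists of propositions;  *)
(* tasks are 0 .. nT-1, task t is labelled by action nth 0 lab t,     *)
(* the strict partial order prec+ is given as the list of pairs       *)
(* (t, t') with t prec+ t'; init is the initial state s0.             *)
(* Compound tasks and methods are not part of the record: for a       *)
(* primitive initial network they do not occur in the definition of   *)
(* a solution.                                         *)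
Record htn_inst := HtnInst {
  nF   : nat;
  acts : seq (seq nat * seq nat * seq nat);
  nT   : nat;
  lab  : seq nat;
  ord  : seq (nat * nat);
  init : seq nat
}.

Definition task (I : htn_inst) := 'I_(nT I).
Definition prop (I : htn_inst) := 'I_(nF I).
Definition state (I : htn_inst) := {set 'I_(nF I)}.

Definition act_of (I : htn_inst) (a : nat) := nth ([::], [::], [::]) (acts I) a.

Definition wf_inst (I : htn_inst) : Prop :=
  all (fun x => let '(p, d, e) := x in
                all (fun f => f < nF I) (p ++ d ++ e)) (acts I) /\
  size (lab I) = nT I /\
  all (fun a => a < size (acts I)) (lab I) /\
  all (fun tt => (tt.1 < nT I) && (tt.2 < nT I)) (ord I) /\
  (forall t, (t, t) \notin ord I) /\
  (forall t1 t2 t3, (t1, t2) \in ord I -> (t2, t3) \in ord I -> (t1, t3) \in ord I) /\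
  all (fun f => f < nF I) (init I).

Definition prec (I : htn_inst) : rel (task I) :=
  fun t t' => (nat_of_ord t, nat_of_ord t') \in ord I.

Definition alpha (I : htn_inst) (t : task I) : nat := nth 0 (lab I) t.

Definition set_of (I : htn_inst) (l : seq nat) : state I :=
  [set x : 'I_(nF I) | nat_of_ord x \in l].

Definition pre_a (I : htn_inst) a : state I := set_of I (act_of I a).1.1.
Definition del_a (I : htn_inst) a : state I := set_of I (act_of I a).1.2.
Definition add_a (I : htn_inst) a : state I := set_of I (act_of I a).2.

Definition exec_act (I : htn_inst) (a : nat) (s : state I) : option (state I) :=
  if pre_a I a \subset s then Some ((s :\: del_a I a) :|: add_a I a) else None.

Definition exec_seq (I : htn_inst) (s : state I) (l : seq nat) : option (state I) :=
  foldl (fun o a => obind (exec_act I a) o) (Some s) l.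

Definition s0 (I : htn_inst) : state I := set_of I (init I).

Definition strict_po_on (I : htn_inst) (T' : {set task I}) (r : rel (task I)) : Prop :=
  (forall t, t \in T' -> ~~ r t t) /\
  (forall t1 t2 t3, t1 \in T' -> t2 \in T' -> t3 \in T' -> r t1 t2 -> r t2 t3 -> r t1 t3).

(* (T', r, alpha|T') is a solution network (the executability of one of
   its linearizations is required separately below). *)
Definition sol_network (I : htn_inst) (T' : {set task I}) (r : rel (task I)) : Prop :=
  [/\ (forall t t', t' \in T' -> prec I t t' -> t \in T'),
      strict_po_on I T' r
    & (forall t t', t \in T' -> t' \in T' -> prec I t t' -> r t t')].

Definition linearization (I : htn_inst) (T' : {set task I}) (r : rel (task I))
    (s : seq (task I)) : Prop :=
  [/\ uniq s, (forall t, (t \in s) = (t \in T'))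
    & (forall t t', t \in T' -> t' \in T' -> r t t' -> index t s < index t' s)].

Definition StateReach (I : htn_inst) (sg : seq nat) : Prop :=
  exists (T' : {set task I}) (r : rel (task I)) (s : seq (task I)),
    [/\ sol_network I T' r, linearization I T' r s &
        exists st, exec_seq I (s0 I) (map (@alpha I) s) = Some st /\ set_of I sg \subset st].

(* Action Executability; the multiset S is given as a list of actions *)
Definition ActionExec (I : htn_inst) (S : seq nat) : Prop :=
  exists (T' : {set task I}) (r : rel (task I)) (s : seq (task I)),
    [/\ sol_network I T' r, linearization I T' r s,
        (exists st, exec_seq I (s0 I) (map (@alpha I) s) = Some st) &
        forall a, count_mem a S <= count_mem a (map (@alpha I) s)].

Definition isolated (I : htn_inst) (t : task I) : Prop :=
  forall t', t' != t -> ~~ prec I t t' && ~~ prec I t' t.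

Definition antichain (I : htn_inst) (A : {set task I}) : Prop :=
  forall a b, a \in A -> b \in A -> a != b -> ~~ prec I a b.

Definition gpow_le (I : htn_inst) (w : nat) : Prop :=
  forall A : {set task I}, (forall a, a \in A -> ~ isolated I a) -> antichain I A -> #|A| <= w.

(* state transition graph: vertices are the states reachable from s0 by
   any sequence of actions of A; "at most k states" *)
Definition reachable (I : htn_inst) (st : state I) : Prop :=
  exists l : seq nat, all (fun a => a < size (acts I)) l /\ exec_seq I (s0 I) l = Some st.

Definition nstates_le (I : htn_inst) (k : nat) : Prop :=
  forall l : seq (state I), uniq l -> (forall st, st \in l -> reachable I st) -> size l <= k.

(* Model of computation: a random access machine with log-cost        *)
(* (each step costs 1 + the bit lengths of all addresses and values   *)
(* involved).                                                          *)
Inductive instr :=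
| IConst of nat & nat
| IAdd of nat & nat & nat
| ISub of nat & nat & nat      (* ISub r a b : R[r] := R[a]-R[b] (truncated) *)
| ILoad of nat & nat
| IStore of nat & nat
| IJz of nat & nat
| IJmp of nat
| IHalt.

Definition program := seq instr.
Definition regs := nat -> nat.

Definition bits (n : nat) : nat := (Nat.log2 n).+1.

Definition upd (R : regs) (r v : nat) : regs := fun x => if x == r then v else R x.

Definition step (i : instr) (pc : nat) (R : regs) : nat * regs * nat :=
  match i with
  | IConst r n => (pc.+1, upd R r n, 1 + bits r + bits n)
  | IAdd r a b => (pc.+1, upd R r (R a + R b),
                   1 + bits r + bits a + bits b + bits (R a) + bits (R b))
  | ISub r a b => (pc.+1, upd R r (R a - R b),
                   1 + bits r + bits a + bits b + bits (R a) + bits (R b))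
  | ILoad r a => (pc.+1, upd R r (R (R a)),
                  1 + bits r + bits a + bits (R a) + bits (R (R a)))
  | IStore a b => (pc.+1, upd R (R a) (R b),
                   1 + bits a + bits b + bits (R a) + bits (R b))
  | IJz r l => ((if R r == 0 then l else pc.+1), R, 1 + bits r + bits (R r) + bits l)
  | IJmp l => (l, R, 1 + bits l)
  | IHalt => (pc, R, 0)
  end.

Fixpoint run (P : program) (fuel pc : nat) (R : regs) : option (nat * nat) :=
  match fuel with
  | 0 => None
  | f.+1 =>
      match nth IHalt P pc with
      | IHalt => Some (R 0, 0)
      | i => let '(pc', R', c) := step i pc R in
             obind (fun oc => Some (oc.1, c + oc.2)) (run P f pc' R')
      end
  end.

Definition init_regs (x : seq nat) : regs :=
  fun i => if i == 0 then size x else nth 0 x i.-1.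

(* size of an input (numbers counted in unary, so that nF, nT etc. are
   accounted for as in an explicit listing) *)
Definition insize (x : seq nat) : nat := \sum_(v <- x) v.+1.

Definition decides_within (P : program) (c d : nat) (x : seq nat) (L : Prop) : Prop :=
  exists fuel o cost, run P fuel 0 (init_regs x) = Some (o, cost) /\
    cost <= c * (insize x).+1 ^ d /\ (o != 0 <-> L).

Definition enc_list (l : seq nat) : seq nat := size l :: l.

Definition enc_inst (I : htn_inst) : seq nat :=
  [:: nF I; size (acts I)] ++
  flatten [seq (let '(p, d, e) := x in enc_list p ++ enc_list d ++ enc_list e)
          | x <- acts I] ++
  nT I :: enc_list (lab I) ++
  enc_list (flatten [seq [:: pr.1; pr.2] | pr <- ord I]) ++
  enc_list (init I).

Definition enc_SR (I : htn_inst) (sg : seq nat) := enc_inst I ++ enc_list sg.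
Definition enc_AE (I : htn_inst) (S : seq nat) := enc_inst I ++ enc_list S.

(* Main.v *)
Require Import Defs.
From mathcomp Require Import all_boot.
From mathcomp Require Import zify.

(** Isolated tasks whose actions act alike on the reachable states are
    interchangeable, and with at most [k] reachable states there are at most
    [(k + 1) ^ k] kinds of behaviour. The executed non-isolated tasks form a
    down-set, generated by its maximal elements, an antichain of at most [w]
    tasks. Hence all that matters about a run is its length, the current state
    (given by at most [k] actions leading to it), [w] generators and one counter
    per kind of isolated task, which leaves polynomially many configurations. A
    table of the configurations of runs is filled by increasing length; it decides
    both problems, because a configuration is reached with any choice of the
    executed isolated tasks that agrees with its counters.

    On the machine, all computations are values of expressions built from input
    and table look-ups, bounded sums and truncated iterations, so that values and
    costs are polynomial for each expression. *)

Set Implicit Arguments.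
Unset Strict Implicit.
Unset Printing Implicit Defensive.

(** * Timed runs of the machine *)

(** The machine knows neither the reachable states nor the classes of actions. A state is therefore
    named by a word of [k] actions, checked for executability, and two actions are declared alike
    when they agree on all valid words among the [base ^ k] codes; as every reachable state has such
    a name, this test is exact. The bound [(k + 1) ^ k] counts the maps from [k] states to [k]
    states plus the outcome of not being executable. A configuration has many names, since different
    words and different generators may stand for the same thing, so steps compare the decoded states
    and down-sets and never their digits. For Action Executability the counters alone are too
    coarse, as one class may contain several actions: the missing occurrences of each action are
    compared with the isolated tasks that carry it and, class by class, with the counter. On the
    machine side, whatever depends only on [k] and [w] is unrolled into the expression, and the
    table holds only bits, so that filling it never enlarges the values involved. *)

Definition reaches (P : program) (pc : nat) (R : regs) (C pc' : nat) (R' : regs) :=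
  exists c, c <= C /\ exists n, forall f,
    run P (n + f) pc R = obind (fun oc => Some (oc.1, c + oc.2)) (run P f pc' R').

Lemma reaches_refl P pc R C : reaches P pc R C pc R.
Proof. by exists 0; split=> //; exists 0 => f; case: run => [[o c]|]. Qed.

Lemma reaches_trans P pc1 R1 C1 pc2 R2 C2 pc3 R3 C :
  reaches P pc1 R1 C1 pc2 R2 -> reaches P pc2 R2 C2 pc3 R3 -> C1 + C2 <= C ->
  reaches P pc1 R1 C pc3 R3.
Proof.
move=> [c1 [le1 [n1 E1]]] [c2 [le2 [n2 E2]]] le; exists (c1 + c2); split; first by lia.
exists (n1 + n2) => f; rewrite -addnA E1 E2.
by case: run => [[o c]|] //=; rewrite addnA.
Qed.

Lemma reaches_le P pc1 R1 C1 pc2 R2 C :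
  reaches P pc1 R1 C1 pc2 R2 -> C1 <= C -> reaches P pc1 R1 C pc2 R2.
Proof. by move=> [c [le1 h]] le; exists c; split=> //; lia. Qed.

(** A step costs 1 plus at most five bit lengths, the maximum being attained by [IAdd] and [ISub].
    Each length is bounded crudely by [X.+1] in [bits_le]. *)
Definition unit_cost X := 6 * X.+1.

Lemma bits_le n X : n <= X -> bits n <= X.+1.
Proof.
move=> le; rewrite /bits ltnS; apply: leq_trans le.
by apply/leP; exact: PeanoNat.Nat.log2_le_lin (PeanoNat.Nat.le_0_l n).
Qed.

Section Steps.
Variables (P : program) (b : nat) (R : regs) (X : nat).

Lemma reaches_const r n : nth IHalt P b = IConst r n -> r <= X -> n <= X ->
  reaches P b R (unit_cost X) b.+1 (upd R r n).
Proof.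
move=> E h1 h2; exists (1 + bits r + bits n); split.
  by move: (bits_le h1) (bits_le h2); rewrite /unit_cost; lia.
by exists 1 => f; rewrite add1n /= E.
Qed.

Lemma reaches_add r a c : nth IHalt P b = IAdd r a c -> r <= X -> a <= X -> c <= X ->
  R a <= X -> R c <= X -> reaches P b R (unit_cost X) b.+1 (upd R r (R a + R c)).
Proof.
move=> E h1 h2 h3 h4 h5.
exists (1 + bits r + bits a + bits c + bits (R a) + bits (R c)); split.
  move: (bits_le h1) (bits_le h2) (bits_le h3) (bits_le h4) (bits_le h5).
  by rewrite /unit_cost; lia.
by exists 1 => f; rewrite add1n /= E.
Qed.

Lemma reaches_sub r a c : nth IHalt P b = ISub r a c -> r <= X -> a <= X -> c <= X ->
  R a <= X -> R c <= X -> reaches P b R (unit_cost X) b.+1 (upd R r (R a - R c)).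
Proof.
move=> E h1 h2 h3 h4 h5.
exists (1 + bits r + bits a + bits c + bits (R a) + bits (R c)); split.
  move: (bits_le h1) (bits_le h2) (bits_le h3) (bits_le h4) (bits_le h5).
  by rewrite /unit_cost; lia.
by exists 1 => f; rewrite add1n /= E.
Qed.

Lemma reaches_load r a : nth IHalt P b = ILoad r a -> r <= X -> a <= X ->
  R a <= X -> R (R a) <= X -> reaches P b R (unit_cost X) b.+1 (upd R r (R (R a))).
Proof.
move=> E h1 h2 h3 h4.
exists (1 + bits r + bits a + bits (R a) + bits (R (R a))); split.
  by move: (bits_le h1) (bits_le h2) (bits_le h3) (bits_le h4); rewrite /unit_cost; lia.
by exists 1 => f; rewrite add1n /= E.
Qed.

Lemma reaches_store a c : nth IHalt P b = IStore a c -> a <= X -> c <= X ->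
  R a <= X -> R c <= X -> reaches P b R (unit_cost X) b.+1 (upd R (R a) (R c)).
Proof.
move=> E h1 h2 h3 h4.
exists (1 + bits a + bits c + bits (R a) + bits (R c)); split.
  by move: (bits_le h1) (bits_le h2) (bits_le h3) (bits_le h4); rewrite /unit_cost; lia.
by exists 1 => f; rewrite add1n /= E.
Qed.

Lemma reaches_jz r l : nth IHalt P b = IJz r l -> r <= X -> l <= X -> R r <= X ->
  reaches P b R (unit_cost X) (if R r == 0 then l else b.+1) R.
Proof.
move=> E h1 h2 h3; exists (1 + bits r + bits (R r) + bits l); split.
  by move: (bits_le h1) (bits_le h2) (bits_le h3); rewrite /unit_cost; lia.
by exists 1 => f; rewrite add1n /= E.
Qed.

Lemma reaches_jmp l : nth IHalt P b = IJmp l -> l <= X ->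
  reaches P b R (unit_cost X) l R.
Proof.
move=> E h1; exists (1 + bits l); split.
  by have := bits_le h1; rewrite /unit_cost; lia.
by exists 1 => f; rewrite add1n /= E.
Qed.

End Steps.
Arguments reaches_const [P b] R [X r n].
Arguments reaches_add [P b] R [X r a c].
Arguments reaches_sub [P b] R [X r a c].
Arguments reaches_load [P b] R [X r a].
Arguments reaches_store [P b] R [X a c].
Arguments reaches_jz [P b] R [X r l].
Arguments reaches_jmp [P b] R [X l].

(** The index of the invariant is the number of rounds still to come, as in the compiled loops,
    which decrement a register and leave at zero. The final exit test is left to the caller. *)
Lemma reaches_loop P b C (Inv : nat -> regs -> Prop) :
  (forall i R, Inv i.+1 R -> exists2 R', reaches P b R C b R' & Inv i R') ->
  forall n R, Inv n R -> exists2 R', reaches P b R (n * C) b R' & Inv 0 R'.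
Proof.
move=> body; elim=> [|n IH] R inv; first by exists R => //; exact: reaches_refl.
have [R1 r1 i1] := body _ _ inv; have [R2 r2 i2] := IH _ i1.
by exists R2 => //; apply: reaches_trans r1 r2 _; rewrite mulSn.
Qed.

Definition code_at (P : program) b (c : program) :=
  forall i, i < size c -> nth IHalt P (b + i) = nth IHalt c i.

Lemma code_at_cat P b c1 c2 :
  code_at P b (c1 ++ c2) -> code_at P b c1 /\ code_at P (b + size c1) c2.
Proof.
move=> h; split=> i lt_i.
  by rewrite h ?size_cat ?nth_cat ?lt_i //; lia.
rewrite -addnA h ?size_cat ?nth_cat; last by lia.
by rewrite ltnNge leq_addr /= addKn.
Qed.

Lemma code_at_cons P b i c :
  code_at P b (i :: c) -> nth IHalt P b = i /\ code_at P b.+1 c.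
Proof.
move=> h; split; first by rewrite -[b]addn0 h.
by move=> j lt_j; rewrite addSnnS h.
Qed.

(** * A language of polynomial time expressions *)

Inductive expr :=
| Var of nat
| Cst of nat
| Add of expr & expr
| Sub of expr & expr
| Inp of expr
| Tab of expr
| If of expr & expr & expr
| Sum of expr & expr
| Iter of expr & expr & expr.

(* [wI] is the input, [wT] a table filled by the program, and [wL] a bound
   on the size of the input at which the values of [Iter] are cut off: this
   is what keeps all values polynomial. *)
Record world := World { wL : nat; wI : nat -> nat; wT : nat -> nat }.

Fixpoint eval (W : world) (env : seq nat) (e : expr) : nat :=
  match e with
  | Var i => nth 0 env i
  | Cst n => n
  | Add a b => eval W env a + eval W env b
  | Sub a b => eval W env a - eval W env b
  | Inp a => wI W (eval W env a)
  | Tab a => wT W (eval W env a)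
  | If a b c => if eval W env a == 0 then eval W env c else eval W env b
  | Sum n f => \sum_(0 <= i < eval W env n) eval W (i :: env) f
  | Iter n z f =>
      iter (eval W env n) (fun v => minn (eval W (v :: env) f) (wL W)) (eval W env z)
  end.

Fixpoint val_bound (e : expr) (V : nat) : nat :=
  match e with
  | Var _ => V
  | Cst n => n
  | Add a b => val_bound a V + val_bound b V
  | Sub a b => val_bound a V + val_bound b V
  | Inp _ => V
  | Tab _ => V
  | If a b c => val_bound b V + val_bound c V
  | Sum n f => val_bound n V * val_bound f (V + val_bound n V)
  | Iter n z f => V + val_bound z V
  end.

Definition world_le (W : world) (V : nat) :=
  [/\ wL W <= V, forall i, wI W i <= V & forall i, wT W i <= V].

Lemma world_leW W V V' : world_le W V -> V <= V' -> world_le W V'.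
Proof. by move=> [h1 h2 h3] le; split=> *; apply: leq_trans le. Qed.

Lemma all_leW (s : seq nat) V V' :
  all (fun v => v <= V) s -> V <= V' -> all (fun v => v <= V') s.
Proof. by move=> /allP h le; apply/allP => v /h; lia. Qed.

Lemma iter_minn_le n (g : nat -> nat) z L V :
  z <= V -> L <= V -> iter n (fun v => minn (g v) L) z <= V.
Proof. by move=> hz hL; elim: n => [|n IH] //=; lia. Qed.

Lemma eval_le e W env V :
  world_le W V -> all (fun v => v <= V) env -> eval W env e <= val_bound e V.
Proof.
elim: e env V => [i|n|a IHa b IHb|a IHa b IHb|a IHa|a IHa|a IHa b IHb c IHc|n IHn f IHf
  |n IHn z IHz f IHf] env V wV eV //=.
- have [lt|ge] := ltnP i (size env); last by rewrite nth_default.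
  by exact: (allP eV _ (mem_nth 0 lt)).
- by move: (IHa _ _ wV eV) (IHb _ _ wV eV); lia.
- by move: (IHa _ _ wV eV) (IHb _ _ wV eV); lia.
- by case: wV.
- by case: wV.
- by move: (IHb _ _ wV eV) (IHc _ _ wV eV); case: ifP; lia.
- have hn := IHn _ _ wV eV.
  rewrite big_nat.
  apply: (@leq_trans (\sum_(0 <= i < eval W env n | 0 <= i < eval W env n)
      val_bound f (V + val_bound n V))).
    apply: leq_sum => i /andP[_ lt_i]; apply: IHf; first by apply: world_leW wV _; lia.
    by rewrite /= (all_leW eV) ?leq_addr // andbT; lia.
  by rewrite -big_nat sum_nat_const_nat subn0 leq_mul2r hn orbT.
- apply: iter_minn_le; first by have := IHz _ _ wV eV; lia.
  by case: wV; lia.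
Qed.

(** Needed apart from [compile], whose forward jumps depend on the length of code not yet emitted.
    An out-of-range variable loads 0 twice there, so that the length is the same for every [rho]. *)
Fixpoint code_size (e : expr) : nat :=
  match e with
  | Var _ => 2
  | Cst _ => 1
  | Add a b => code_size a + (code_size b + 1)
  | Sub a b => code_size a + (code_size b + 1)
  | Inp a => code_size a + 3
  | Tab a => code_size a + 3
  | If a b c => code_size a + (code_size b + (code_size c).+1).+1
  | Sum n f => code_size n + (code_size f + 2).+4
  | Iter n z f => code_size z + (code_size n + (code_size f + 3).+3)
  end.

(** Bounds the scratch registers used from [d] on; sums instead of maxima are crude but enough,
    since only a constant is needed. *)
Fixpoint depth (e : expr) : nat :=
  match e with
  | Var _ => 1
  | Cst _ => 1
  | Add a b => depth a + (depth b).+1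
  | Sub a b => depth a + (depth b).+1
  | Inp a => depth a
  | Tab a => depth a
  | If a b c => depth a + depth b + depth c
  | Sum n f => (depth n + depth f).+3
  | Iter n z f => (depth n + depth z + depth f).+3
  end.

(* The value of variable [i] is in register [nth 0 rho i]; the result goes to
   register [d], and only registers from [d] on are modified. Registers 0 and 1
   hold the base addresses of the (interleaved) input and table. [b] is the
   address of the code. *)
Fixpoint compile (e : expr) (rho : seq nat) (d b : nat) : program :=
  match e with
  | Var i => if i < size rho then [:: IConst d 0; IAdd d d (nth 0 rho i)]
             else [:: IConst d 0; IConst d 0]
  | Cst n => [:: IConst d n]
  | Add a c => compile a rho d b ++ compile c rho d.+1 (b + code_size a) ++ [:: IAdd d d d.+1]
  | Sub a c => compile a rho d b ++ compile c rho d.+1 (b + code_size a) ++ [:: ISub d d d.+1]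
  | Inp a => compile a rho d b ++ [:: IAdd d d d; IAdd d d 0; ILoad d d]
  | Tab a => compile a rho d b ++ [:: IAdd d d d; IAdd d d 1; ILoad d d]
  | If a t c =>
      compile a rho d b ++ IJz d (b + code_size a + code_size t).+2 ::
      compile t rho d (b + code_size a).+1 ++ IJmp (b + code_size (If a t c)) ::
      compile c rho d (b + code_size a + code_size t).+2
  | Sum n f =>
      compile n rho d.+1 b ++ [:: IConst d 0, IJz d.+1 (b + code_size (Sum n f)),
        IConst d.+2 1, ISub d.+1 d.+1 d.+2 &
      compile f (d.+1 :: rho) d.+2 (b + code_size n).+4 ++
      [:: IAdd d d d.+2; IJmp (b + code_size n).+1]]
  | Iter n z f =>
      compile z rho d b ++ compile n rho d.+1 (b + code_size z) ++
      [:: IJz d.+1 (b + code_size (Iter n z f)), IConst d.+2 1, ISub d.+1 d.+1 d.+2 &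
      compile f (d :: rho) d.+2 (b + code_size z + code_size n).+3 ++
      [:: ISub d d.+2 0; ISub d d.+2 d; IJmp (b + code_size z + code_size n)]]
  end.

Lemma size_compile e rho d b : size (compile e rho d b) = code_size e.
Proof.
elim: e rho d b => [i|n|a IHa c IHc|a IHa c IHc|a IHa|a IHa|a IHa t IHt c IHc|n IHn f IHf
  |n IHn z IHz f IHf] rho d b //=; rewrite ?size_cat /= ?size_cat /= ?size_cat /=;
  rewrite ?IHa ?IHc ?IHt ?IHn ?IHf ?IHz //.
by case: ifP.
Qed.

Lemma reaches_end P pc R pc' : pc = pc' -> reaches P pc R 0 pc' R.
Proof. by move=> ->; apply: reaches_refl. Qed.

Tactic Notation "chain" uconstr(step) := eapply reaches_trans; [eapply step | | apply: leqnn].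

(** * Correctness and cost of compiled expressions *)

Section Compile.
Variables (m Z : nat) (P : program).

(** [Z] bounds code addresses and register numbers, whose bit lengths are charged too. In the two
    loops the factor [N.+1] instead of [N] also pays for the exit test. *)
Fixpoint cost_bound (e : expr) (V : nat) : nat :=
  match e with
  | Var _ => 2 * unit_cost (Z + V)
  | Cst n => unit_cost (Z + n)
  | Add a b => cost_bound a V + cost_bound b V + unit_cost (Z + val_bound a V + val_bound b V)
  | Sub a b => cost_bound a V + cost_bound b V + unit_cost (Z + val_bound a V + val_bound b V)
  | Inp a => cost_bound a V + 3 * unit_cost (Z + (2 * val_bound a V + (2 * V + 1)))
  | Tab a => cost_bound a V + 3 * unit_cost (Z + (2 * val_bound a V + (2 * V + 1)))
  | If a b c =>
      cost_bound a V + cost_bound b V + cost_bound c V + 2 * unit_cost (Z + val_bound a V)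
  | Sum n f =>
      let N := val_bound n V in
      let F := val_bound f (V + N) in
      cost_bound n V + unit_cost Z +
      N.+1 * (cost_bound f (V + N) + 5 * unit_cost (Z + (N + N * F + F + 1)))
  | Iter n z f =>
      let N := val_bound n V in
      let V' := V + val_bound z V in
      let F := val_bound f V' in
      cost_bound z V + cost_bound n V +
      N.+1 * (cost_bound f V' + 6 * unit_cost (Z + (N + V' + F + 1)))
  end.

(** Input cells lie at even and table cells at odd distance from [wL W], so neither array needs a
    length fixed in advance; [m <= wL W] keeps both above the scratch registers. *)
Definition represents (W : world) (R : regs) :=
  [/\ m <= wL W, R 0 = wL W, R 1 = (wL W).+1,
      forall i, R (i + i + wL W) = wI W i &
      forall i, R (i + i + (wL W).+1) = wT W i].

Definition agree d (R R' : regs) := forall r, (r < d) || (m <= r) -> R' r = R r.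

Lemma represents_agree W d R R' :
  represents W R -> 2 <= d -> agree d R R' -> represents W R'.
Proof.
by move=> [h1 h2 h3 h4 h5] led h; split=> // [||i|i]; rewrite h ?h2 ?h3 ?h4 ?h5 //; lia.
Qed.

Lemma agree_trans d d' R1 R2 R3 : agree d R1 R2 -> agree d' R2 R3 -> d <= d' -> agree d R1 R3.
Proof. by move=> h1 h2 le r hr; rewrite h2 ?h1 //; lia. Qed.

Lemma agree_upd d r v R R' : agree d R R' -> d <= r < m -> agree d R (upd R' r v).
Proof. by move=> h le x hx; rewrite /upd; case: eqP => [?|_]; [lia|rewrite h]. Qed.

Lemma map_agree d R R' rho :
  agree d R R' -> all (fun r => r < d) rho -> map R' rho = map R rho.
Proof. by move=> h /allP hr; apply/eq_in_map => r /hr lt; apply: h; rewrite lt. Qed.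

Definition correct (e : expr) := forall rho d b W V R,
  code_at P b (compile e rho d b) ->
  2 <= d -> d + depth e <= m -> m <= Z -> b + code_size e <= Z ->
  all (fun r => r < d) rho -> represents W R ->
  world_le W V -> all (fun v => v <= V) (map R rho) ->
  exists R', [/\ reaches P b R (cost_bound e V) (b + code_size e) R',
                 R' d = eval W (map R rho) e & agree d R R'].

Lemma upd_same R r v : upd R r v r = v. Proof. by rewrite /upd eqxx. Qed.
Lemma upd_diff R r v x : x != r -> upd R r v x = R x.
Proof. by rewrite /upd => /negbTE->. Qed.

Lemma depth_gt0 e : 0 < depth e.
Proof. by elim: e => //= *; lia. Qed.

Lemma correct_Var i : correct (Var i).
Proof.
move=> rho d b W V R /= hc le2 hd hm hb hrho hR hW hV.
have [lt|ge] := ltnP i (size rho); move: hc; rewrite ?lt ?(ltnNge i) ?ge /=;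
  move=> /code_at_cons[c1 /code_at_cons[c2 _]].
  have ltr : nth 0 rho i < d by exact: (allP hrho _ (mem_nth 0 lt)).
  have leV : R (nth 0 rho i) <= V.
    by rewrite -(nth_map 0 0 R lt); apply: (allP hV); rewrite mem_nth ?size_map.
  eexists; split.
  - eapply reaches_le.
      chain (reaches_const (X := Z + V) R c1); try lia.
      chain (reaches_add (X := Z + V) _ c2);
        rewrite ?upd_same ?upd_diff; try lia.
      by apply: reaches_end; lia.
    by rewrite /=; lia.
  - by rewrite upd_same ?upd_diff ?(nth_map 0) //; lia.
  - by do !(apply: agree_upd; last lia).
eexists; split.
- eapply reaches_le.
    chain (reaches_const (X := Z + V) R c1); try lia.
    chain (reaches_const (X := Z + V) _ c2); try lia.
    by apply: reaches_end; lia.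
  by rewrite /=; lia.
- by rewrite !upd_same nth_default // size_map.
- by do !(apply: agree_upd; last lia).
Qed.

Lemma all_ltS rho d : all (fun r => r < d) rho -> all (fun r => r < d.+1) rho.
Proof. by move=> /allP h; apply/allP => r /h /ltnW. Qed.

Lemma correct_Cst n : correct (Cst n).
Proof.
move=> rho d b W V R /= /code_at_cons[c1 _] le2 hd hm hb hrho hR hW hV.
eexists; split.
- by rewrite addn1; apply: (reaches_const (X := Z + n) R c1); lia.
- by rewrite upd_same.
- by do !(apply: agree_upd; last lia).
Qed.

(** Shared by [Add] and [Sub]: the first value survives in [d] because the second computation writes
    only from [d.+1] on. *)
Lemma correct_binary a c rho d b W V R :
  correct a -> correct c ->
  code_at P b (compile a rho d b) ->
  code_at P (b + code_size a) (compile c rho d.+1 (b + code_size a)) ->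
  2 <= d -> d + (depth a + (depth c).+1) <= m -> m <= Z ->
  b + (code_size a + (code_size c + 1)) <= Z ->
  all (fun r => r < d) rho -> represents W R ->
  world_le W V -> all (fun v => v <= V) (map R rho) ->
  exists R', [/\ reaches P b R (cost_bound a V + cost_bound c V)
                   (b + code_size a + code_size c) R',
                 R' d = eval W (map R rho) a, R' d.+1 = eval W (map R rho) c & agree d R R'].
Proof.
move=> IHa IHc ca cc le2 hd hm hb hrho hR hW hV.
have da := depth_gt0 a; have dc := depth_gt0 c.
have [||||||||R1 [r1 v1 g1]] := IHa rho d b W V R ca => //; try lia.
have [||||||||R2 [r2 v2 g2]] := IHc rho d.+1 (b + code_size a) W V R1 cc => //;
  rewrite ?(map_agree g1) //; try lia.
- exact: all_ltS.
- exact: represents_agree hR le2 g1.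
exists R2; split=> //.
- exact: reaches_trans r1 r2 _.
- by rewrite g2 ?v1 ?ltnSn.
- by rewrite v2 (map_agree g1).
- exact: agree_trans g1 g2 _.
Qed.

Lemma correct_Add a c : correct a -> correct c -> correct (Add a c).
Proof.
move=> IHa IHc rho d b W V R /= /code_at_cat[ca /code_at_cat[cc]] ci le2 hd hm hb hrho hR hW hV.
move: ci cc; rewrite !size_compile => /code_at_cons[ci _] cc.
have da := depth_gt0 a; have dc := depth_gt0 c.
have [R2 [r2 v1 v2 g2]] := correct_binary IHa IHc ca cc le2 hd hm hb hrho hR hW hV.
have la := eval_le a hW hV; have lc := eval_le c hW hV.
eexists; split.
- eapply reaches_le.
    chain r2.
    chain (reaches_add (X := Z + val_bound a V + val_bound c V) _ ci); rewrite ?v1 ?v2; try lia.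
    by apply: reaches_end; lia.
  by rewrite /=; lia.
- by rewrite upd_same ?v1 ?v2.
- by do !(apply: agree_upd; last lia).
Qed.

Lemma correct_Sub a c : correct a -> correct c -> correct (Sub a c).
Proof.
move=> IHa IHc rho d b W V R /= /code_at_cat[ca /code_at_cat[cc]] ci le2 hd hm hb hrho hR hW hV.
move: ci cc; rewrite !size_compile => /code_at_cons[ci _] cc.
have da := depth_gt0 a; have dc := depth_gt0 c.
have [R2 [r2 v1 v2 g2]] := correct_binary IHa IHc ca cc le2 hd hm hb hrho hR hW hV.
have la := eval_le a hW hV; have lc := eval_le c hW hV.
eexists; split.
- eapply reaches_le.
    chain r2.
    chain (reaches_sub (X := Z + val_bound a V + val_bound c V) _ ci); rewrite ?v1 ?v2; try lia.
    by apply: reaches_end; lia.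
  by rewrite /=; lia.
- by rewrite upd_same ?v1 ?v2.
- by do !(apply: agree_upd; last lia).
Qed.

(** Serves [Inp] with [q = 0] and [Tab] with [q = 1]: doubling the index and adding the base selects
    a cell of the interleaved memory. The bound is [V.+1] because the table starts one cell after
    [wL W]. *)
Lemma correct_access a q base (g : nat -> nat) rho d b W V R :
  correct a -> q < 2 -> m <= base <= V.+1 -> (forall i, g i <= V) -> R q = base ->
  (forall i, R (i + i + base) = g i) ->
  code_at P b (compile a rho d b ++ [:: IAdd d d d; IAdd d d q; ILoad d d]) ->
  2 <= d -> d + depth a <= m -> m <= Z -> b + (code_size a + 3) <= Z ->
  all (fun r => r < d) rho -> represents W R ->
  world_le W V -> all (fun v => v <= V) (map R rho) ->
  exists R', [/\ reaches P b R (cost_bound a V + 3 * unit_cost (Z + (2 * val_bound a V + (2 * V + 1))))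
                   (b + (code_size a + 3)) R',
                 R' d = g (eval W (map R rho) a) & agree d R R'].
Proof.
move=> IHa lt2 hbase hg hq hmem /code_at_cat[ca]; rewrite size_compile.
move=> /code_at_cons[c1 /code_at_cons[c2 /code_at_cons[c3 _]]] le2 hd hm hb hrho hR hW hV.
have da := depth_gt0 a; have la := eval_le a hW hV.
have [||||||||R1 [r1 v1 g1]] := IHa rho d b W V R ca => //; try lia.
set v := eval _ _ a in v1 la *.
set X := Z + _.
pose R2 := upd R1 d (v + v); pose R3 := upd R2 d (v + v + base).
have eR2 : upd R1 d (R1 d + R1 d) = R2 by rewrite v1.
have eR3 : upd R2 d (R2 d + R2 q) = R3.
  by rewrite /R3 /R2 upd_same upd_diff ?g1 ?hq //; lia.
have eR4 : R3 (R3 d) = g v.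
  rewrite {2}/R3 upd_same /R3 /R2 !upd_diff; try lia.
  by rewrite g1 ?hmem //; lia.
have := hg v; exists (upd R3 d (g v)); split.
- eapply reaches_le.
    chain r1.
    chain (reaches_add (X := X) _ c1); try lia.
    rewrite eR2; chain (reaches_add (X := X) _ c2); rewrite ?/R2 ?upd_same ?upd_diff ?g1 ?hq; try lia.
    rewrite -/R2 -hq -(g1 q) ?eR3; last lia.
    have -> : upd R2 d (v + v + R1 q) = R3 by rewrite g1 ?hq //; lia.
    chain (reaches_load (X := X) _ c3); rewrite ?eR4 /R3 ?upd_same; try lia.
    by rewrite -/R3; apply: reaches_end; lia.
  by rewrite -/X; lia.
- by rewrite upd_same.
- by do !(apply: agree_upd; last lia).
Qed.

Lemma correct_Inp a : correct a -> correct (Inp a).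
Proof.
move=> IHa rho d b W V R /= hc le2 hd hm hb hrho hR hW hV.
case: (hR) (hW) => h1 h2 h3 h4 h5 [k1 k2 k3].
by apply: (correct_access (base := wL W) IHa _ _ k2 h2 h4 hc) => //; lia.
Qed.

Lemma correct_Tab a : correct a -> correct (Tab a).
Proof.
move=> IHa rho d b W V R /= hc le2 hd hm hb hrho hR hW hV.
case: (hR) (hW) => h1 h2 h3 h4 h5 [k1 k2 k3].
by apply: (correct_access (base := (wL W).+1) IHa _ _ k3 h3 h5 hc) => //; lia.
Qed.

Lemma correct_If a t c : correct a -> correct t -> correct c -> correct (If a t c).
Proof.
move=> IHa IHt IHc rho d b W V R /= /code_at_cat[ca]; rewrite size_compile.
move=> /code_at_cons[c1 /code_at_cat[ct]]; rewrite size_compile => /code_at_cons[c2 cc].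
move=> le2 hd hm hb hrho hR hW hV.
have := depth_gt0 a; have := depth_gt0 t; have := depth_gt0 c => d1 d2 d3.
have la := eval_le a hW hV.
have [||||||||R1 [r1 v1 g1]] := IHa rho d b W V R ca => //; try lia.
have hR1 := represents_agree hR le2 g1.
have e1 := map_agree g1 hrho.
have jz := reaches_jz R1 (X := Z + val_bound a V) c1.
case: (posnP (eval W (map R rho) a)) => [E|E]; rewrite v1 ?E ?eqxx ?(gtn_eqF E) in jz *.
  have e2 : (b + code_size a).+1 + code_size t = (b + code_size a + code_size t).+1 by lia.
  rewrite e2 in cc.
  have [||||||||R2 [r2 v2 g2]] := IHc rho d _ W V R1 cc; rewrite ?e1 //; try lia.
  exists R2; split; [|by rewrite v2 e1|exact: agree_trans g1 g2 _].
  eapply reaches_le.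
    chain r1.
    chain jz; try lia.
    chain r2.
    by apply: reaches_end; lia.
  by rewrite /=; lia.
have [||||||||R2 [r2 v2 g2]] := IHt rho d _ W V R1 ct; rewrite ?e1 //; try lia.
exists R2; split; [|by rewrite v2 e1|exact: agree_trans g1 g2 _].
eapply reaches_le.
  chain r1.
  chain jz; try lia.
  chain r2.
  chain (reaches_jmp _ (X := Z + val_bound a V) c2); try lia.
  by apply: reaches_end; lia.
by rewrite /=; lia.
Qed.

Lemma sum_nat_le (F : nat -> nat) i n N B :
  (forall j, j < n -> F j <= B) -> n <= N -> \sum_(i <= j < n) F j <= N * B.
Proof.
move=> hF le; apply: (@leq_trans (\sum_(i <= j < n) B)).
  by rewrite !big_nat; apply: leq_sum => j /andP[_ /hF].
by rewrite sum_nat_const_nat leq_mul2r; apply/orP; right; lia.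
Qed.

(** The counter is decremented before the body runs, so one register is both the number of remaining
    rounds and the summation index; the sum is accumulated from its last term down. *)
Lemma correct_Sum n f : correct n -> correct f -> correct (Sum n f).
Proof.
move=> IHn IHf rho d b W V R /= /code_at_cat[cn]; rewrite size_compile.
move=> /code_at_cons[c1 /code_at_cons[c2 /code_at_cons[c3 /code_at_cons[c4 /code_at_cat[cf]]]]].
rewrite size_compile => /code_at_cons[c5 /code_at_cons[c6 _]].
move=> le2 hd hm hb hrho hR hW hV.
have := depth_gt0 n; have := depth_gt0 f => d1 d2.
have ln := eval_le n hW hV.
have [||||||||R1 [r1 v1 g1]] := IHn rho d.+1 b W V R cn => //; try lia.
  exact: all_ltS.
set N := eval W (map R rho) n in ln v1 *.
set NB := val_bound n V in ln *; set FB := val_bound f _; set X := Z + (_ + 1).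
pose F i := eval W (i :: map R rho) f.
have hF i : i < N -> F i <= FB.
  move=> lt; apply: eval_le; first by apply: world_leW hW _; lia.
  by rewrite /= (all_leW hV) ?leq_addr // andbT; lia.
pose Inv i R' := [/\ agree d R R', R' d.+1 = i, i <= N & R' d = \sum_(i <= j < N) F j].
have body i R2 : Inv i.+1 R2 -> exists2 R', reaches P (b + code_size n).+1 R2
    (cost_bound f (V + NB) + 5 * unit_cost X) (b + code_size n).+1 R' & Inv i R'.
  move=> [g2 k2 le_i s2].
  have hs2 : R2 d <= NB * FB by rewrite s2; apply: sum_nat_le.
  pose R3 := upd R2 d.+2 1; pose R4 := upd R3 d.+1 i.
  have eR4 : upd R3 d.+1 (R3 d.+1 - R3 d.+2) = R4.
    by rewrite /R4 /R3 upd_same upd_diff ?k2; [rewrite subn1|lia].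
  have g4 : agree d R R4 by do !(apply: agree_upd; last lia).
  have R4d : R4 d = R2 d by rewrite /R4 /R3 !upd_diff //; lia.
  have R4d1 : R4 d.+1 = i by rewrite /R4 upd_same.
  have [||||||||R5 [r5 v5 g5]] := IHf (d.+1 :: rho) d.+2 _ W (V + NB) R4 cf; try lia.
  + by rewrite /= ltnSn; apply/all_ltS/all_ltS.
  + exact: represents_agree hR le2 g4.
  + by apply: world_leW hW _; lia.
  + by rewrite /= R4d1 (map_agree g4 hrho) (all_leW hV) ?leq_addr // andbT; lia.
  move: v5; rewrite /= R4d1 (map_agree g4 hrho) -/(F i) => v5.
  have R5d : R5 d = R2 d by rewrite g5 ?R4d //; lia.
  have R5d1 : R5 d.+1 = i by rewrite g5 ?R4d1 //; lia.
  have := hF _ le_i => leF.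
  exists (upd R5 d (R5 d + R5 d.+2)).
    eapply reaches_le.
      chain (reaches_jz _ (X := X) c2); try lia.
      rewrite k2 /=; chain (reaches_const _ (X := X) c3); try lia.
      rewrite -/R3; chain (reaches_sub _ (X := X) c4);
        rewrite ?/R3 ?upd_same ?upd_diff ?k2; try lia.
      rewrite -/R3; have -> : upd R3 d.+1 (i.+1 - 1) = R4 by rewrite subn1.
      chain r5.
      chain (reaches_add _ (X := X) c5); rewrite ?R5d ?v5; try lia.
      chain (reaches_jmp _ (X := X) c6); try lia.
      by apply: reaches_end; lia.
    by lia.
  split.
  + by apply: agree_upd; [apply: agree_trans g4 g5 _; lia | lia].
  + by rewrite upd_diff //; lia.
  + by lia.
  + by rewrite upd_same R5d v5 s2 addnC -big_ltn.
have [|R3 r3 [g3 k3 _ s3]] := reaches_loop body (n := N) (R := upd R1 d 0).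
  split=> //.
  + by apply: agree_upd; [move=> r hr; apply: g1; lia | lia].
  + by rewrite upd_diff ?v1 //; lia.
  + by rewrite upd_same big_geq.
exists R3; split=> //.
eapply reaches_le.
  chain r1.
  chain (reaches_const _ (X := Z) c1); try lia.
  chain r3.
  chain (reaches_jz _ (X := X) c2); try lia.
  by rewrite k3 /=; apply: reaches_end; lia.
rewrite mulSn; have : N * (cost_bound f (V + NB) + 5 * unit_cost X) <=
  NB * (cost_bound f (V + NB) + 5 * unit_cost X) by rewrite leq_mul2r ln orbT.
by lia.
Qed.

(** With truncated subtraction, [v - (v - wL W)] equals [minn v (wL W)]; this is the pair of [ISub]
    after the body, register 0 holding [wL W]. The iterate stays in [d], which is itself the bound
    variable of the body. *)
Lemma correct_Iter n z f : correct n -> correct z -> correct f -> correct (Iter n z f).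
Proof.
move=> IHn IHz IHf rho d b W V R /= /code_at_cat[cz /code_at_cat[]]; rewrite !size_compile.
move=> cn /code_at_cons[c1 /code_at_cons[c2 /code_at_cons[c3 /code_at_cat[cf]]]].
rewrite size_compile => /code_at_cons[c4 /code_at_cons[c5 /code_at_cons[c6 _]]].
move=> le2 hd hm hb hrho hR hW hV.
have := depth_gt0 n; have := depth_gt0 f; have := depth_gt0 z => d1 d2 d3.
have ln := eval_le n hW hV; have lz := eval_le z hW hV.
have [||||||||R0 [r0 v0 g0]] := IHz rho d b W V R cz => //; try lia.
have [||||||||R1 [r1 v1 g1]] := IHn rho d.+1 _ W V R0 cn;
  rewrite ?(map_agree g0 hrho) //; try lia.
- exact: all_ltS.
- exact: represents_agree hR le2 g0.
rewrite (map_agree g0 hrho) in v1.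
set N := eval W (map R rho) n in ln v1 *.
set NB := val_bound n V in ln *; set V' := V + _; set FB := val_bound f _; set X := Z + (_ + 1).
pose F v := eval W (v :: map R rho) f.
have hL : wL W <= V by case: hW.
pose G v := minn (F v) (wL W).
have hG i : iter i G (eval W (map R rho) z) <= V' by apply: iter_minn_le; lia.
pose Inv i R' := [/\ agree d R R', R' d.+1 = i, i <= N &
  R' d = iter (N - i) G (eval W (map R rho) z)].
have body i R2 : Inv i.+1 R2 -> exists2 R', reaches P (b + code_size z + code_size n) R2
    (cost_bound f V' + 6 * unit_cost X) (b + code_size z + code_size n) R' & Inv i R'.
  move=> [g2 k2 le_i s2].
  have hs2 : R2 d <= V' by rewrite s2.
  pose R3 := upd R2 d.+2 1; pose R4 := upd R3 d.+1 i.
  have g4 : agree d R R4 by do !(apply: agree_upd; last lia).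
  have R4d : R4 d = R2 d by rewrite /R4 /R3 !upd_diff //; lia.
  have R4d1 : R4 d.+1 = i by rewrite /R4 upd_same.
  have [||||||||R5 [r5 v5 g5]] := IHf (d :: rho) d.+2 _ W V' R4 cf; try lia.
  + by rewrite /= ltnW //; apply/all_ltS/all_ltS.
  + exact: represents_agree hR le2 g4.
  + by apply: world_leW hW _; lia.
  + by rewrite /= R4d (map_agree g4 hrho) (all_leW hV) ?leq_addr // andbT; lia.
  move: v5; rewrite /= R4d (map_agree g4 hrho) -/(F (R2 d)) => v5.
  have R5d : R5 d = R2 d by rewrite g5 ?R4d //; lia.
  have R5d1 : R5 d.+1 = i by rewrite g5 ?R4d1 //; lia.
  have R50 : R5 0 = wL W.
    by rewrite g5; [rewrite g4; [case: hR | lia] | lia].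
  have leF : F (R2 d) <= FB.
    apply: eval_le; first by apply: world_leW hW _; lia.
    by rewrite /= (all_leW hV) ?leq_addr // andbT; lia.
  pose R6 := upd R5 d (F (R2 d) - wL W).
  exists (upd R6 d (R6 d.+2 - R6 d)).
    eapply reaches_le.
      chain (reaches_jz _ (X := X) c1); try lia.
      rewrite k2 /=; chain (reaches_const _ (X := X) c2); try lia.
      rewrite -/R3; chain (reaches_sub _ (X := X) c3);
        rewrite ?/R3 ?upd_same ?upd_diff ?k2; try lia.
      rewrite -/R3; have -> : upd R3 d.+1 (i.+1 - 1) = R4 by rewrite subn1.
      chain r5.
      chain (reaches_sub _ (X := X) c4); rewrite ?R50 ?v5; try lia.
      rewrite -/R6; chain (reaches_sub _ (X := X) c5);
        rewrite ?/R6 ?upd_same ?upd_diff ?v5; try lia.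
      rewrite -/R6; chain (reaches_jmp _ (X := X) c6); try lia.
      by rewrite /R6; apply: reaches_end; lia.
    by lia.
  split.
  + by do !(apply: agree_upd; last lia); apply: agree_trans g4 g5 _; lia.
  + by rewrite /R6 !upd_diff //; lia.
  + by lia.
  + rewrite upd_same /R6 upd_same upd_diff ?v5; last by lia.
    have -> : N - i = (N - i.+1).+1 by lia.
    by rewrite iterS -s2 /G; lia.
have [|R3 r3 [g3 k3 _ s3]] := reaches_loop body (n := N) (R := R1).
  split=> //; first by apply: agree_trans g0 g1 _; lia.
  by rewrite g1 ?v0 ?subnn //; lia.
exists R3; split=> //; last by rewrite s3 subn0.
eapply reaches_le.
  chain r0.
  chain r1.
  chain r3.
  chain (reaches_jz _ (X := X) c1); try lia.
  by rewrite k3 /=; apply: reaches_end; lia.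
rewrite mulSn; have : N * (cost_bound f V' + 6 * unit_cost X) <=
  NB * (cost_bound f V' + 6 * unit_cost X) by rewrite leq_mul2r ln orbT.
by rewrite -/V'; lia.
Qed.

Lemma compile_correct e : correct e.
Proof.
elim: e => *; [exact: correct_Var | exact: correct_Cst | exact: correct_Add
 | exact: correct_Sub | exact: correct_Inp | exact: correct_Tab | exact: correct_If
 | exact: correct_Sum | exact: correct_Iter].
Qed.

End Compile.

(** * Polynomial bounds on values and costs *)

Definition poly_bounded (f : nat -> nat) := exists c d, forall n, f n <= c * n.+1 ^ d.

Lemma poly_bounded_const c : poly_bounded (fun _ => c).
Proof. by exists c, 0 => n; rewrite muln1. Qed.

Lemma poly_bounded_id : poly_bounded (fun n => n).
Proof. by exists 1, 1 => n; rewrite mul1n expn1. Qed.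

Lemma poly_bounded_le f g : poly_bounded g -> (forall n, f n <= g n) -> poly_bounded f.
Proof. by move=> [c [d h]] le; exists c, d => n; apply: leq_trans (le n) (h n). Qed.

Lemma poly_bounded_add f g :
  poly_bounded f -> poly_bounded g -> poly_bounded (fun n => f n + g n).
Proof.
move=> [c1 [d1 h1]] [c2 [d2 h2]]; exists (c1 + c2), (d1 + d2) => n.
rewrite mulnDl leq_add //.
  by apply: leq_trans (h1 n) _; rewrite leq_mul2l leq_pexp2l ?leq_addr ?orbT.
by apply: leq_trans (h2 n) _; rewrite leq_mul2l leq_pexp2l ?leq_addl ?orbT.
Qed.

Lemma poly_bounded_mul f g :
  poly_bounded f -> poly_bounded g -> poly_bounded (fun n => f n * g n).
Proof.
move=> [c1 [d1 h1]] [c2 [d2 h2]]; exists (c1 * c2), (d1 + d2) => n.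
by rewrite expnD mulnACA leq_mul.
Qed.

Lemma poly_bounded_comp f g :
  poly_bounded f -> poly_bounded g -> poly_bounded (fun n => f (g n)).
Proof.
move=> [c1 [d1 h1]] [c2 [d2 h2]]; exists (c1 * c2.+1 ^ d1), (d2 * d1) => n.
apply: leq_trans (h1 _) _; rewrite -mulnA leq_mul2l; apply/orP; right.
rewrite expnM -expnMn; have [->|d1_gt0] := posnP d1; first by rewrite !expn0.
rewrite leq_exp2r // mulSn; have := h2 n; have : 0 < n.+1 ^ d2 by rewrite expn_gt0.
by lia.
Qed.

Lemma poly_bounded_unit_cost f : poly_bounded f -> poly_bounded (fun n => unit_cost (f n)).
Proof.
move=> hf; apply: (@poly_bounded_comp unit_cost f) => //.
by exists 6, 1 => n; rewrite expn1 /unit_cost.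
Qed.

Ltac pbound := repeat
  match goal with
  | |- poly_bounded (addn ?a) => change (poly_bounded (fun V => a + V))
  | |- poly_bounded (muln ?a) => change (poly_bounded (fun V => a * V))
  | |- poly_bounded (fun _ => _ + _) => apply: poly_bounded_add
  | |- poly_bounded (fun _ => _ * _) => apply: poly_bounded_mul
  | |- poly_bounded (fun _ => unit_cost _) => apply: poly_bounded_unit_cost
  | |- poly_bounded (fun V => V) => exact: poly_bounded_id
  | |- _ => first [exact: poly_bounded_const | assumption]
  end.

Lemma poly_val_bound e : poly_bounded (val_bound e).
Proof.
elim: e => [i|n|a IHa c IHc|a IHa c IHc|a IHa|a IHa|a IHa t IHt c IHc|n IHn f IHf
  |n IHn z IHz f IHf] /=; pbound.
by apply: (@poly_bounded_comp (val_bound f)) => //; pbound.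
Qed.

Lemma poly_cost_bound Z e : poly_bounded (cost_bound Z e).
Proof.
elim: e => [i|n|a IHa c IHc|a IHa c IHc|a IHa|a IHa|a IHa t IHt c IHc|n IHn f IHf
  |n IHn z IHz f IHf] /=;
  try (by pbound; apply: poly_val_bound).
  have hn := poly_val_bound n.
  have hf : poly_bounded (fun V => val_bound f (V + val_bound n V)).
    by apply: (@poly_bounded_comp (val_bound f)); [exact: poly_val_bound | pbound].
  have hc : poly_bounded (fun V => cost_bound Z f (V + val_bound n V)).
    by apply: (@poly_bounded_comp (cost_bound Z f)) => //; pbound.
  pbound; apply: (@poly_bounded_le _ (fun V => val_bound n V + 1)); last by lia.
  by pbound.
have hn := poly_val_bound n; have hz := poly_val_bound z.
have hf : poly_bounded (fun V => val_bound f (V + val_bound z V)).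
  by apply: (@poly_bounded_comp (val_bound f)); [exact: poly_val_bound | pbound].
have hc : poly_bounded (fun V => cost_bound Z f (V + val_bound z V)).
  by apply: (@poly_bounded_comp (cost_bound Z f)) => //; pbound.
pbound; apply: (@poly_bounded_le _ (fun V => val_bound n V + 1)); last by lia.
by pbound.
Qed.

(** * Moving the input out of the low registers *)

Definition save_regs m : program :=
  flatten [seq [:: IAdd 0 0 1; IStore 0 j] | j <- iota 2 m].

(* Multiplying register 0, which holds the input size [n], by [2 ^ m] gives an
   address [L] above the input and the [m] scratch registers. Once register 1
   is saved at [L], it holds the stride 2. *)
Definition prelude m : program :=
  nseq m.+1 (IAdd 0 0 0) ++ [:: IStore 0 1; IConst 1 2] ++ save_regs m ++
  [:: IConst 3 (m + m); ISub 4 0 3; IConst 2 m.+2; ISub 5 4 2; IConst 3 1] ++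
  (let b := m.+1 + (m + m) + 7 in
   [:: IJz 5 (b + 7); ILoad 6 2; IAdd 0 0 1; IStore 0 6; IAdd 2 2 3; ISub 5 5 3; IJmp b;
       IConst 0 0; IAdd 0 0 4; IAdd 1 0 3]).

Lemma size_save_regs m : size (save_regs m) = m + m.
Proof.
rewrite /save_regs -{2 3}(size_iota 2 m); elim: (iota 2 m) => //= j s ->.
by rewrite addSn addnS.
Qed.

Lemma size_prelude m : size (prelude m) = m + m + m + 18.
Proof. by rewrite /prelude !size_cat size_nseq size_save_regs /=; lia. Qed.

Section Prelude.
Variables (P : program) (m : nat) (x : seq nat) (X L : nat).
Hypothesis L_def : L = 2 ^ m.+1 * size x.
Hypothesis x_gt0 : 0 < size x.
Hypothesis m_ge : 6 <= m.
Hypothesis x_le : forall i, nth 0 x i <= X.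
Hypothesis X_ge : 4 * L + 3 * m + 20 <= X.

(** Input entry [i] starts in register [i.+1], since register 0 holds the length. Registers past the
    input are 0, so copying may run on to [L] without knowing where the input ends. *)
Definition copied t (R : regs) :=
  [/\ forall a, m.+1 < a < L -> R a = nth 0 x a.-1,
      forall i, R (i + i + L) = if i < t then nth 0 x i else 0 &
      forall i, R (i + i + L.+1) = 0].

Lemma L_bounds : [/\ 2 * size x <= L, m.+1 < L & 0 < L].
Proof.
have h : m.+1 < 2 ^ m.+1 by apply: ltn_expl.
have h2 : 2 ^ m.+1 <= L by rewrite L_def leq_pmulr.
split; [rewrite L_def expnS|exact: leq_trans h h2|exact: leq_ltn_trans (leq_trans h h2)].
by rewrite -mulnA leq_mul2l leq_pmull // expn_gt0.
Qed.

Lemma copied_low t R r v : copied t R -> r <= m.+1 -> copied t (upd R r v).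
Proof.
case: L_bounds => l1 l2 l3 [h1 h2 h3] le.
by split=> [a ha|i|i]; rewrite upd_diff; [exact: h1| |exact: h2| |exact: h3|]; lia.
Qed.

Lemma copied_store t R : copied t R -> copied t.+1 (upd R (t + t + L) (nth 0 x t)).
Proof.
case: L_bounds => l1 l2 l3 [h1 h2 h3]; split=> [a ha|i|i].
- by rewrite upd_diff ?h1 //; lia.
- have [->|ne] := eqVneq i t; first by rewrite upd_same ltnSn.
  rewrite upd_diff ?h2; last by lia.
  by rewrite ltnS [in RHS]leq_eqVlt (negbTE ne).
- by rewrite upd_diff ?h3 //; lia.
Qed.

(** Doubling in place needs no scratch register. At this moment every other register may hold input,
    so register 0 is the only one that can be changed. *)
Lemma doubling j b R : code_at P b (nseq j (IAdd 0 0 0)) -> 2 ^ j * R 0 <= X ->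
  exists R', [/\ reaches P b R (j * unit_cost X) (b + j) R', R' 0 = 2 ^ j * R 0 &
                 forall r, r != 0 -> R' r = R r].
Proof.
elim: j b R => [|j IH] b R.
  by exists R; split; [apply: reaches_end; lia | rewrite mul1n |].
rewrite /= => /code_at_cons[c1 c2]; rewrite expnS => le.
have e0 : upd R 0 (R 0 + R 0) 0 = 2 * R 0 by rewrite upd_same; lia.
have le0 : R 0 <= X.
  by apply: leq_trans le; rewrite leq_pmull // muln_gt0 expn_gt0.
have [|R' [r' v' g']] := IH _ (upd R 0 (R 0 + R 0)) c2; rewrite ?e0; first by lia.
exists R'; split.
- eapply reaches_le.
    chain (reaches_add _ (X := X) c1); try lia.
    chain r'.
    by apply: reaches_end; lia.
  by lia.
- by rewrite v' e0; lia.
- by move=> r hr; rewrite g' // upd_diff.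
Qed.

(** Unrolled, because a loop would need scratch registers and these still hold input: [IStore 0 j]
    names its source in the instruction, register 0 carries the target address and register 1 the
    stride. *)
Lemma save_regs_correct j s b R :
  code_at P b (flatten [seq [:: IAdd 0 0 1; IStore 0 i] | i <- iota s j]) ->
  2 <= s -> s + j <= m.+2 -> R 0 = L + 2 * (s - 2) -> R 1 = 2 ->
  (forall r, s <= r <= m.+1 -> R r = nth 0 x r.-1) -> copied s.-1 R ->
  exists R', [/\ reaches P b R (j * (2 * unit_cost X)) (b + (j + j)) R',
     R' 0 = L + 2 * (s + j - 2), R' 1 = 2 & copied (s + j).-1 R'].
Proof.
case: L_bounds => l1 l2 l3.
elim: j s b R => [|j IH] s b R.
  by move=> *; exists R; split; rewrite ?addn0 //; apply: reaches_refl.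
rewrite /= => /code_at_cons[c1 /code_at_cons[c2 c3]] h1 h2 h3 h4 h5 h6.
pose R1 := upd R 0 (s.-1 + s.-1 + L); pose R2 := upd R1 (s.-1 + s.-1 + L) (nth 0 x s.-1).
have e1 : upd R 0 (R 0 + R 1) = R1 by rewrite /R1 h3 h4; congr upd; lia.
have e2 : upd R1 (R1 0) (R1 s) = R2.
  by rewrite /R2 /R1 upd_same upd_diff ?h5 //; lia.
have R1s : R1 s = nth 0 x s.-1 by rewrite /R1 upd_diff ?h5 //; lia.
have xs := x_le s.-1.
have [||||||R' [r' v0 v1 g']] := IH s.+1 b.+2 R2 c3; try lia.
- by rewrite /R2 upd_diff /R1 ?upd_same; lia.
- by rewrite /R2 upd_diff /R1 ?upd_diff; lia.
- by move=> r hr; rewrite /R2 upd_diff /R1 ?upd_diff ?h5; lia.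
- have -> : s.+1.-1 = (s.-1).+1 by lia.
  by apply: copied_store; apply: copied_low.
have ej : s + j.+1 = s.+1 + j by lia.
exists R'; split; rewrite ?ej //.
eapply reaches_le.
  chain (reaches_add _ (X := X) c1); try lia.
  rewrite e1; chain (reaches_store _ (X := X) c2); try lia.
    by rewrite /R1 upd_same; lia.
  rewrite e2; chain r'.
  by apply: reaches_end; lia.
by lia.
Qed.

(** The low registers are saved by now and free. Register 0 is the target, 1 the stride, 2 the
    source, 3 the constant one, 4 keeps [L], 5 counts the remaining entries and 6 carries the entry
    in transit. Surplus rounds beyond the input copy zeros. *)
Lemma copy_loop b R :
  code_at P b [:: IJz 5 (b + 7); ILoad 6 2; IAdd 0 0 1; IStore 0 6; IAdd 2 2 3; ISub 5 5 3; IJmp b] ->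
  b + 7 <= X -> R 0 = L + (m + m) -> R 1 = 2 -> R 2 = m.+2 -> R 3 = 1 -> R 4 = L ->
  R 5 = L - m.+2 -> copied m.+1 R ->
  exists R', [/\ reaches P b R (L * (7 * unit_cost X)) (b + 7) R',
    R' 3 = 1, R' 4 = L & copied L.-1 R'].
Proof.
case: L_bounds => l1 l2 l3.
move=> /code_at_cons[c1 /code_at_cons[c2 /code_at_cons[c3 /code_at_cons[c4
  /code_at_cons[c5 /code_at_cons[c6 /code_at_cons[c7 _]]]]]]] hb v0 v1 v2 v3 v4 v5 h.
pose Inv j R' := [/\ R' 0 = L + 2 * (L - j - 2), R' 2 = L - j, R' 5 = j,
  [/\ R' 1 = 2, R' 3 = 1, R' 4 = L & j <= L - m.+2] & copied (L - j).-1 R'].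
have body j R1 : Inv j.+1 R1 -> exists2 R', reaches P b R1 (7 * unit_cost X) b R' & Inv j R'.
  move=> [w0 w2 w5 [w1 w3 w4 le] hc].
  set s := L - j.+1 in w0 w2 hc *.
  have hs : m.+1 < s < L by lia.
  have xs := x_le s.-1.
  have ex : R1 s = nth 0 x s.-1 by case: hc => -> //; lia.
  pose R2 := upd R1 6 (nth 0 x s.-1).
  pose R3 := upd R2 0 (s.-1 + s.-1 + L).
  pose R4 := upd R3 (s.-1 + s.-1 + L) (nth 0 x s.-1).
  pose R5 := upd R4 2 s.+1.
  pose R6 := upd R5 5 j.
  have E r v R' q : q <> r -> upd R' r v q = R' q by move=> ?; rewrite upd_diff //; apply/eqP.
  have e2 : upd R1 6 (R1 (R1 2)) = R2 by rewrite /R2 w2 ex.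
  have e3 : upd R2 0 (R2 0 + R2 1) = R3 by rewrite /R3 /R2 !E // w0 w1; congr upd; lia.
  have e4 : upd R3 (R3 0) (R3 6) = R4.
    by rewrite /R4 {2}/R3 upd_same; congr upd; rewrite /R3 /R2 E ?upd_same.
  have e5 : upd R4 2 (R4 2 + R4 3) = R5.
    by rewrite /R5; congr upd; rewrite /R4 /R3 /R2 !E ?w2 ?w3 ?addn1 //; lia.
  have e6 : upd R5 5 (R5 5 - R5 3) = R6.
    by rewrite /R6; congr upd; rewrite /R5 /R4 /R3 /R2 !E ?w5 ?w3 ?subn1 //; lia.
  exists R6.
    eapply reaches_le.
      chain (reaches_jz _ (X := X) c1); try lia.
      rewrite w5 /=; chain (reaches_load _ (X := X) c2); rewrite ?w2 ?ex; try lia.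
      rewrite -ex -w2 e2; chain (reaches_add _ (X := X) c3); rewrite ?/R2 ?E; try lia.
      rewrite -/R2; have -> : upd R2 0 (R1 0 + R1 1) = R3 by rewrite -e3 /R2 !E.
      chain (reaches_store _ (X := X) c4); try lia.
        by rewrite /R3 upd_same; lia.
        by rewrite /R3 /R2 E // upd_same.
      rewrite e4; chain (reaches_add _ (X := X) c5); try lia.
        by rewrite /R4 /R3 /R2 !E; lia.
        by rewrite /R4 /R3 /R2 !E; lia.
      rewrite e5; chain (reaches_sub _ (X := X) c6); try lia.
        by rewrite /R5 /R4 /R3 /R2 !E; lia.
        by rewrite /R5 /R4 /R3 /R2 !E; lia.
      rewrite e6; chain (reaches_jmp _ (X := X) c7); try lia.
      by apply: reaches_end.
    by lia.
  split.
  - by rewrite /R6 /R5 /R4 /R3 3?E ?upd_same; lia.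
  - by rewrite /R6 /R5 E ?upd_same; lia.
  - by rewrite /R6 upd_same.
  - by split; rewrite ?/R6 ?/R5 ?/R4 ?/R3 ?/R2 ?E; lia.
  - have -> : (L - j).-1 = (s.-1).+1 by lia.
    do 2!(apply: copied_low; last by lia).
    by apply: copied_store; do 2!(apply: copied_low; last by lia).
have [|R' r' [w0 w2 w5 [w1 w3 w4 _] hc]] := reaches_loop body (n := L - m.+2) (R := R).
  split=> //; try lia.
  by have -> : (L - (L - m.+2)).-1 = m.+1 by lia.
exists R'; split=> //; last by rewrite subn0 in hc.
eapply reaches_le.
  chain r'.
  chain (reaches_jz _ (X := X) c1); try lia.
  by rewrite w5 /=; apply: reaches_end.
have : (L - m.+2).+1 * (7 * unit_cost X) <= L * (7 * unit_cost X).
  by rewrite leq_mul2r; apply/orP; right; lia.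
by lia.
Qed.

Lemma prelude_correct : code_at P 0 (prelude m) ->
  exists2 R', reaches P 0 (init_regs x) ((7 * L + 3 * m + 20) * unit_cost X) (size (prelude m)) R' &
    represents m (World L (nth 0 x) (fun _ => 0)) R'.
Proof.
case: L_bounds => l1 l2 l3.
rewrite size_prelude => /code_at_cat[cd]; rewrite size_nseq add0n.
move=> /code_at_cons[s1 /code_at_cons[s2 /code_at_cat[cs]]].
rewrite size_save_regs => /code_at_cons[q1 /code_at_cons[q2 /code_at_cons[q3
  /code_at_cons[q4 /code_at_cons[q5]]]]].
have eb : (m.+3 + (m + m)).+4.+1 = m.+1 + (m + m) + 7 by lia.
rewrite eb; set b := (_ + 7) in eb *.
move=> hc; have [cl] := @code_at_cat P b [:: IJz 5 (b + 7); ILoad 6 2; IAdd 0 0 1; IStore 0 6;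
  IAdd 2 2 3; ISub 5 5 3; IJmp b] [:: IConst 0 0; IAdd 0 0 4; IAdd 1 0 3] hc.
rewrite /= => /code_at_cons[f1 /code_at_cons[f2 /code_at_cons[f3 _]]].
have E r v R' q : q <> r -> upd R' r v q = R' q by move=> ?; rewrite upd_diff //; apply/eqP.
have [|R1 [r1 v1 g1]] := @doubling m.+1 0 (init_regs x) cd; first by rewrite -L_def; lia.
rewrite -L_def in v1.
have R1E a : a != 0 -> R1 a = nth 0 x a.-1.
  by move=> ha; rewrite g1 // /init_regs (negbTE ha).
have x0 := x_le 0; have R1_1 : R1 1 = nth 0 x 0 by rewrite R1E.
pose R2 := upd (upd R1 L (nth 0 x 0)) 1 2.
have copied1 : copied 1 R2.
  apply: copied_low; last by [].
  apply: (@copied_store 0); split=> [a ha|i|i]; rewrite R1E; try lia.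
  - by rewrite nth_default //; lia.
  - by rewrite nth_default //; lia.
have [||||||R3 [r3 w0 w1 g3]] := @save_regs_correct m 2 _ R2 cs; try lia.
- by rewrite /R2 !E ?v1; lia.
- by rewrite /R2 upd_same.
- by move=> r hr; rewrite /R2 !E ?R1E; lia.
- exact: copied1.
have w0' : R3 0 = L + (m + m) by rewrite w0; lia.
pose R4 := upd R3 3 (m + m); pose R5 := upd R4 4 L; pose R6 := upd R5 2 m.+2.
pose R7 := upd R6 5 (L - m.+2); pose R8 := upd R7 3 1.
have e5 : upd R4 4 (R4 0 - R4 3) = R5 by rewrite /R5 /R4 upd_same E // w0' addnK.
have e7 : upd R6 5 (R6 4 - R6 2) = R7.
  by rewrite /R7 /R6 upd_same E // /R5 upd_same.
have [||||||||R9 [r9 y3 y4 g9]] := @copy_loop b R8 cl; try lia.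
- by rewrite /R8 /R7 /R6 /R5 /R4 !E.
- by rewrite /R8 /R7 /R6 /R5 /R4 !E.
- by rewrite /R8 /R7 2?E // /R6 upd_same.
- by rewrite /R8 upd_same.
- by rewrite /R8 /R7 /R6 3?E // /R5 upd_same.
- by rewrite /R8 E // /R7 upd_same.
- by do 5!(apply: copied_low; last by lia).
pose R10 := upd R9 0 0; pose R11 := upd R10 0 L; pose R12 := upd R11 1 L.+1.
have e11 : upd R10 0 (R10 0 + R10 4) = R11 by rewrite /R11 /R10 upd_same E // y4.
have e12 : upd R11 1 (R11 0 + R11 3) = R12.
  by rewrite /R12 /R11 upd_same /R10 !E // y3 addn1.
exists R12.
  eapply reaches_le.
    chain r1.
    chain (reaches_store _ (X := X) s1); rewrite ?v1 ?R1_1; try lia.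
    chain (reaches_const _ (X := X) s2); try lia.
    rewrite -/R2; chain r3.
    chain (reaches_const _ (X := X) q1); try lia.
    rewrite -/R4; chain (reaches_sub _ (X := X) q2); rewrite ?e5; try lia;
      try (by rewrite /R4 E; lia); try (by rewrite /R4 upd_same; lia).
    chain (reaches_const _ (X := X) q3); try lia.
    rewrite -/R6; chain (reaches_sub _ (X := X) q4); rewrite ?e7; try lia;
      try (by rewrite /R6 /R5 E // upd_same; lia); try (by rewrite /R6 upd_same; lia).
    chain (reaches_const _ (X := X) q5); try lia.
    rewrite -/R8 eb; chain r9.
    chain (reaches_const _ (X := X) f1); try lia.
    rewrite -/R10; chain (reaches_add _ (X := X) f2); rewrite ?e11; try lia;
      try (by rewrite /R10 upd_same; lia); try (by rewrite /R10 E // y4; lia).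
    chain (reaches_add _ (X := X) f3); rewrite ?e12; try lia;
      try (by rewrite /R11 upd_same; lia); try (by rewrite /R11 /R10 !E // y3; lia).
    by apply: reaches_end; lia.
  by rewrite !mulnDl; lia.
have [h1 h2 h3] : copied L.-1 R12 by do 3!(apply: copied_low; last by lia).
split=> //=; first by lia.
(* Indices from [L.-1] on lie beyond the input by [2 * size x <= L], so the 0 stored there agrees
   with the default of [nth]. *)
- by move=> i; rewrite h2; case: ltnP => // ge; rewrite nth_default //; lia.
Qed.

End Prelude.

(** * Programs that fill a table and evaluate an expression on it *)

Lemma size_le_insize x : size x <= insize x.
Proof.
rewrite /insize; elim: x => [|v x IH]; first by rewrite big_nil.
by rewrite big_cons /=; lia.
Qed.

Lemma nth_le_insize x i : nth 0 x i <= insize x.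
Proof.
rewrite /insize; elim: x i => [|v x IH] [|i] //=; first by rewrite big_cons; lia.
by rewrite big_cons; have := IH i; lia.
Qed.

(** Entry [n'] is computed while only smaller entries are filled. Reducing it to a bit keeps the
    value bound the same through all rounds; feeding back full values would compound it. *)
Fixpoint table (L : nat) (I : nat -> nat) (e : expr) (n : nat) : nat -> nat :=
  if n is n'.+1 then
    let T := table L I e n' in upd T n' (eval (World L I T) [:: n'] e != 0)
  else fun _ => 0.

Lemma table_le1 L I e n i : table L I e n i <= 1.
Proof. by elim: n => //= n IH; rewrite /upd; case: eqP => // _; case: eqP. Qed.

Section Main.
Variables (eS e1 e2 : expr).

(** The slack 20 generously covers the fixed registers 0 to 5 and the two extra levels of [body],
    and yields the [6 <= m] required by the prelude. *)
Let m := depth eS + depth e1 + depth e2 + 20.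
Let body := If e1 (Cst 1) (Cst 0).
Let b0 := size (prelude m).
Let loop := (b0 + code_size eS).+1.
Let fin := (loop + code_size body).+1 + 7.

(** The value of [eS] lands in register 3, which counts down. Register 2 is the table index and the
    only variable of [body], whose bit appears in register 4; register 5 is a temporary, first for
    the table address. *)
Definition fill_program : program :=
  prelude m ++ compile eS [::] 3 b0 ++
  [:: IConst 2 0, IJz 3 fin & compile body [:: 2] 4 loop.+1 ++
  [:: IAdd 5 2 2, IAdd 5 5 1, IStore 5 4, IConst 5 1, IAdd 2 2 5, ISub 3 3 5, IJmp loop &
  compile e2 [::] 2 fin ++ [:: IConst 0 0; IAdd 0 0 2; IHalt]]].

Let Z := size fill_program + m.

Definition fill_cost V :=
  let N := val_bound eS V in
  let X := Z + 4 * V + 2 * N + val_bound e2 V + 20 in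
  (7 * V + 3 * m + 20) * unit_cost (4 * V + 3 * m + 20) + cost_bound Z eS V +
  N * (cost_bound Z body (V + N) + 8 * unit_cost X) + cost_bound Z e2 V + 4 * unit_cost X.

Lemma poly_fill_cost : poly_bounded fill_cost.
Proof.
have h1 := poly_val_bound eS; have h2 := poly_val_bound e2.
have h3 := poly_cost_bound Z eS; have h4 := poly_cost_bound Z e2.
have h5 : poly_bounded (fun V => cost_bound Z body (V + val_bound eS V)).
  apply: (@poly_bounded_comp (cost_bound Z body)); first exact: poly_cost_bound.
  by pbound.
by rewrite /fill_cost; pbound.
Qed.

Lemma fill_program_correct x (L := 2 ^ m.+1 * size x) V :
  0 < size x -> L <= V -> (forall i, nth 0 x i <= V) -> 0 < V ->
  let I := nth 0 x in
  let S := eval (World L I (fun _ => 0)) [::] eS in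
  exists fuel c, run fill_program fuel 0 (init_regs x) =
    Some (eval (World L I (table L I e1 S)) [::] e2, c) /\ c <= fill_cost V.
Proof.
move=> x_gt0 LV xV V_gt0 I S.
have eP : code_at fill_program 0 fill_program by [].
(* Only the code inside [code_at] stays concrete: the rest of the proof is about any program [P]
   that contains it. *)
move: {-2}fill_program eP (leqnn Z) => P.
rewrite {1}/fill_program => /code_at_cat[c0 /code_at_cat[cS]]; rewrite -/b0 size_compile add0n.
move=> /code_at_cons[p1 /code_at_cons[p2 /code_at_cat[cB]]]; rewrite size_compile.
move=> /code_at_cons[p3 /code_at_cons[p4 /code_at_cons[p5 /code_at_cons[p6
  /code_at_cons[p7 /code_at_cons[p8 /code_at_cons[p9 /code_at_cat[ce]]]]]]]].
rewrite size_compile => /code_at_cons[p10 /code_at_cons[p11 /code_at_cons[p12 _]]] _.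
have efin : (b0 + code_size eS).+2 + code_size body = (loop + code_size body).+1 by [].
rewrite -/loop in p1 p2 cB p3 p4 p5 p6 p7 p8 p9 ce p10 p11 p12.
have szB : code_size body = code_size e1 + 4 by rewrite /= ?addn1 ?addnS; lia.
have hZ : Z = b0 + (code_size eS + (code_size body + (code_size e2 + 3) + 9)) + m.
  by rewrite /Z /fill_program !size_cat /= !size_cat /= !size_cat /= !size_compile /b0 size_prelude
    size_nseq size_save_regs; lia.
have efin2 : (loop.+1 + code_size body).+4.+3 = fin by rewrite /fin; lia.
rewrite efin2 in ce p10 p11 p12.
set N := val_bound eS V; set X := Z + 4 * V + 2 * N + val_bound e2 V + 20.
have hbody : depth body = depth e1 + 2 by rewrite /= -addnA.
have wV T : (forall i, T i <= 1) -> world_le (World L I T) V.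
  by move=> hT; split=> //= i; apply: leq_trans (hT i) V_gt0.
have tV n := wV _ (table_le1 L I e1 n).
have [|||R1 r1 hR1] := @prelude_correct P m x (4 * V + 3 * m + 20) L (erefl _) x_gt0 _ _ _ c0.
- by rewrite /m; lia.
- by move=> i; have := xV i; lia.
- by lia.
have wT0 : world_le (World L I (fun _ => 0)) V by apply: wV.
have [||||||R2 [r2 v2 g2]] := compile_correct (Z := Z) cS _ _ _ _ _ hR1 wT0 (V := V); try lia.
- by [].
- by [].
rewrite /= -/S in v2.
have SN : S <= N by apply: (eval_le _ wT0).
pose R3 := upd R2 2 0.
pose Inv i R := [/\ represents m (World L I (table L I e1 (S - i))) R, R 2 = S - i, R 3 = i & i <= S].
have bodyP i R : Inv i.+1 R -> exists2 R', reaches P loop R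
    (cost_bound Z body (V + N) + 8 * unit_cost X) loop R' & Inv i R'.
  move=> [hR w2 w3 le].
  set j := S - i.+1 in w2 hR *.
  have [||||||R4 [r4 v4 g4]] := compile_correct (Z := Z) cB _ _ _ _ _ hR (world_leW (tV j) (leq_addr N V)) (V := V + N);
    rewrite ?hbody; try lia.
  - by [].
  - by rewrite /= w2 andbT; lia.
  rewrite /= w2 in v4; set v := if _ then _ else _ in v4.
  have v_le : v <= 1 by rewrite /v; case: ifP.
  have hR4 := represents_agree hR (isT : 2 <= 4) g4.
  pose R5 := upd R4 5 (j + j); pose R6 := upd R5 5 (j + j + L.+1).
  pose R7 := upd R6 (j + j + L.+1) v; pose R8 := upd R7 5 1; pose R9 := upd R8 2 j.+1.
  pose R10 := upd R9 3 i.
  have E r w R' q : q <> r -> upd R' r w q = R' q by move=> ?; rewrite upd_diff //; apply/eqP.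
  have R42 : R4 2 = j by rewrite g4.
  have R43 : R4 3 = i.+1 by rewrite g4.
  have [k1 k2 k3 k4 k5] := hR4; rewrite /= in k1 k2 k3 k4 k5.
  have mL : 20 <= L by apply: leq_trans k1; rewrite /m; lia.
  have q1 : upd R4 5 (R4 2 + R4 2) = R5 by rewrite R42.
  have q2 : upd R5 5 (R5 5 + R5 1) = R6 by rewrite /R6 /R5 upd_same E ?k3.
  have q3 : upd R6 (R6 5) (R6 4) = R7.
    by rewrite /R7 {2}/R6 upd_same /R6 /R5 !E ?v4.
  have q5 : upd R8 2 (R8 2 + R8 5) = R9.
    by rewrite /R9 /R8 upd_same E // /R7 /R6 /R5 !E ?R42 ?addn1 //; lia.
  have q6 : upd R9 3 (R9 3 - R9 5) = R10.
    rewrite /R10 /R9 !E // /R8 upd_same E // /R7 /R6 /R5 !E ?R43 ?subn1 //; lia.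
  exists R10.
    eapply reaches_le.
      chain (reaches_jz _ (X := X) p2); try lia.
      rewrite w3 /=; chain r4.
      chain (reaches_add _ (X := X) p3); try lia.
      rewrite q1; chain (reaches_add _ (X := X) p4); rewrite ?q2; try lia;
        try (by rewrite /R5 upd_same; lia); try (by rewrite /R5 E // k3; lia).
      chain (reaches_store _ (X := X) p5); rewrite ?q3; try lia;
        try (by rewrite /R6 upd_same; lia); try (by rewrite /R6 /R5 !E // v4; lia).
      chain (reaches_const _ (X := X) p6); try lia.
      rewrite -/R8; chain (reaches_add _ (X := X) p7); rewrite ?q5; try lia;
        try (by rewrite /R8 upd_same; lia); try (by rewrite /R8 /R7 /R6 /R5 !E; lia).
      chain (reaches_sub _ (X := X) p8); rewrite ?q6; try lia;
        try (by rewrite /R9 /R8 /R7 /R6 /R5 !E; lia);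
        try (by rewrite /R9 E // /R8 upd_same; lia).
      chain (reaches_jmp _ (X := X) p9); try lia.
      by apply: reaches_end.
    by lia.
  split; last by lia.
  - have -> : S - i = j.+1 by lia.
    split=> //=.
    + by rewrite /R10 /R9 /R8 /R7 /R6 /R5 !E ?k2 //; lia.
    + by rewrite /R10 /R9 /R8 /R7 /R6 /R5 !E ?k3 //; lia.
    + by move=> q; rewrite /R10 /R9 /R8 /R7 /R6 /R5 !E ?k4 //; lia.
    + move=> q; have -> : R10 (q + q + L.+1) = R7 (q + q + L.+1).
        by rewrite /R10 /R9 /R8 !E //; lia.
      rewrite /R7; case: (eqVneq q j) => [->|ne].
        by rewrite upd_same upd_same /v; case: eqP.
      by rewrite (upd_diff _ _ ne) /R6 /R5 !E ?k5 //; lia.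
  - by rewrite /R10 E // /R9 upd_same; lia.
  - by rewrite /R10 upd_same.
have [|R4 r4 [hR4 w2 w3 _]] := reaches_loop bodyP (n := S) (R := R3).
  split=> //.
  - rewrite subnn; apply: (@represents_agree _ _ 2 R2) => //.
      exact: represents_agree hR1 _ g2.
    by move=> r hr; rewrite /R3 upd_diff //; lia.
  - by rewrite subnn /R3 upd_same.
rewrite subn0 in hR4.
have [||||||R5 [r5 v5 g5]] := compile_correct (Z := Z) ce _ _ _ _ _ hR4 (tV S) (V := V); try lia.
- by [].
- by [].
rewrite /= in v5.
have v5le : R5 2 <= val_bound e2 V by rewrite v5; apply: (eval_le _ (tV S)).
pose R6 := upd R5 0 0; pose R7 := upd R6 0 (R5 2).
have [c [le [n hn]]] : reaches P 0 (init_regs x) (fill_cost V) (fin + code_size e2).+2 R7.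
  eapply reaches_le.
    chain r1.
    chain r2.
    chain (reaches_const _ (X := X) p1); try lia.
    rewrite -/R3 -/loop; chain r4.
    chain (reaches_jz _ (X := X) p2); try lia.
    rewrite w3 /=; chain r5.
    chain (reaches_const _ (X := X) p10); try lia.
    rewrite -/R6; chain (reaches_add _ (X := X) p11); try lia.
      by rewrite /R6 upd_same; lia.
      by rewrite /R6 upd_diff; lia.
    by apply: reaches_end.
  rewrite /fill_cost -/N -/X !mulnDl.
  have : S * (cost_bound Z body (V + N) + 8 * unit_cost X) <=
    N * (cost_bound Z body (V + N) + 8 * unit_cost X) by rewrite leq_mul2r SN orbT.
  have : L * unit_cost (4 * V + 3 * m + 20) <= V * unit_cost (4 * V + 3 * m + 20).
    by rewrite leq_mul2r LV orbT.
  by lia.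
exists (n + 1), c; split=> //.
by rewrite hn /= p12 /= addn0 /R7 upd_same v5.
Qed.

End Main.

(** [q] depends on the expressions because [L] has to lie above the scratch registers that their
    depths count. Readers of the input only use [size x <= L]. *)
Theorem table_program eS e1 e2 : exists P c d q, forall x, x != [::] ->
  let L := q * size x in
  let I := nth 0 x in
  let S := eval (World L I (fun _ => 0)) [::] eS in
  size x <= L /\ exists fuel cost, run P fuel 0 (init_regs x) =
    Some (eval (World L I (table L I e1 S)) [::] e2, cost) /\ cost <= c * (insize x).+1 ^ d.
Proof.
set q := 2 ^ (depth eS + depth e1 + depth e2 + 20).+1.
(* With [B] the input size, [(q + 1) * B + 1] dominates [L], all input entries and the bits of the
   table, which is all that [fill_cost] asks of its argument. *)
have [|c [d h]] := @poly_bounded_comp (fill_cost eS e1 e2) (fun B => (q + 1) * B + 1)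
  (poly_fill_cost eS e1 e2); first by pbound.
exists (fill_program eS e1 e2), c, d, q => x x_ne L I S.
have x_gt0 : 0 < size x by case: x x_ne {L I S}.
have szx := size_le_insize x.
have q_gt0 : 0 < q by rewrite expn_gt0.
split; first by rewrite leq_pmull.
have leL : L <= q * insize x by rewrite leq_mul2l szx orbT.
have [|||fuel [cost [E le]]] := @fill_program_correct eS e1 e2 x ((q + 1) * insize x + 1) x_gt0.
- by rewrite -/q -/L mulnDl; lia.
- by move=> i; have := nth_le_insize x i; rewrite mulnDl; lia.
- by rewrite addn1.
by exists fuel, cost; split; rewrite ?E //; apply: leq_trans le (h _).
Qed.

(** * Computable functions of an environment *)

Definition computable (f : world -> seq nat -> nat) :=
  exists e, forall W env, eval W env e = f W env.

Definition computableb (f : world -> seq nat -> bool) :=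
  computable (fun W env => nat_of_bool (f W env)).

Lemma computable_ext f g : computable g -> (forall W env, f W env = g W env) -> computable f.
Proof. by move=> [e he] fg; exists e => W env; rewrite he fg. Qed.

Lemma computableb_ext f g : computableb g -> (forall W env, f W env = g W env) -> computableb f.
Proof. by move=> hg fg; apply: computable_ext hg _ => W env; rewrite fg. Qed.

Lemma computable_const n : computable (fun _ _ => n).
Proof. by exists (Cst n). Qed.

Lemma computable_head : computable (fun _ env => head 0 env).
Proof. by exists (Var 0) => W [|v env]. Qed.

Fixpoint shift c e :=
  match e with
  | Var i => Var (if i < c then i else i.+1)
  | Cst n => Cst n
  | Add a b => Add (shift c a) (shift c b)
  | Sub a b => Sub (shift c a) (shift c b)
  | Inp a => Inp (shift c a)
  | Tab a => Tab (shift c a)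
  | If a b d => If (shift c a) (shift c b) (shift c d)
  | Sum n f => Sum (shift c n) (shift c.+1 f)
  | Iter n z f => Iter (shift c n) (shift c z) (shift c.+1 f)
  end.

Lemma eval_shift W e pre v env :
  eval W (pre ++ v :: env) (shift (size pre) e) = eval W (pre ++ env) e.
Proof.
elim: e pre => [i|n|a IHa b IHb|a IHa b IHb|a IHa|a IHa|a IHa b IHb d IHd|n IHn f IHf
  |n IHn z IHz f IHf] pre //=; rewrite ?IHa ?IHb ?IHd ?IHn ?IHz //.
- case: (ltnP i (size pre)) => [lt|le]; rewrite !nth_cat; first by rewrite lt.
  by rewrite !ltnNge le (leqW le) /= subSn.
- by apply: eq_bigr => i _; rewrite -(IHf (i :: pre)).
- by apply: eq_iter => u; rewrite -(IHf (u :: pre)).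
Qed.

(** Weakening: below a binder, an expression over the outer environment has to skip the new variable
    0, which [shift] does. In an empty environment all lookups outside the local binders give 0,
    shifted or not; the second induction deals with that. *)
Lemma computable_behead f : computable f -> computable (fun W env => f W (behead env)).
Proof.
move=> [e he]; exists (shift 0 e) => W [|v env]; last by rewrite (eval_shift W e [::]) he.
rewrite -he /=.
have gen : forall e pre, eval W pre (shift (size pre) e) = eval W pre e.
  move=> {e he f}; elim=> [i|n|a IHa b IHb|a IHa b IHb|a IHa|a IHa|a IHa b IHb d IHd|n IHn f IHf
    |n IHn z IHz f IHf] pre //=; rewrite ?IHa ?IHb ?IHd ?IHn ?IHz //.
  - by case: ltnP => // le; rewrite !nth_default //; lia.
  - by apply: eq_bigr => i _; rewrite -(IHf (i :: pre)).
  - by apply: eq_iter => u; rewrite -(IHf (u :: pre)).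
exact: (gen e [::]).
Qed.

Section Closure.
Variables (f g h : world -> seq nat -> nat) (a b : world -> seq nat -> bool).
Hypotheses (cf : computable f) (cg : computable g) (ch : computable h).
Hypotheses (ca : computableb a) (cb : computableb b).

Lemma computable_add : computable (fun W env => f W env + g W env).
Proof. by case: cf cg => [e he] [e' he']; exists (Add e e') => W env /=; rewrite he he'. Qed.

Lemma computable_sub : computable (fun W env => f W env - g W env).
Proof. by case: cf cg => [e he] [e' he']; exists (Sub e e') => W env /=; rewrite he he'. Qed.

Lemma computable_succ : computable (fun W env => (f W env).+1).
Proof. by case: cf => [e he]; exists (Add e (Cst 1)) => W env /=; rewrite he addn1. Qed.

Lemma computable_pred : computable (fun W env => (f W env).-1).
Proof. by case: cf => [e he]; exists (Sub e (Cst 1)) => W env /=; rewrite he subn1. Qed.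

(** The language has no product; a sum with constant summand replaces it. *)
Lemma computable_mul : computable (fun W env => f W env * g W env).
Proof.
case: cf => e he; case: (computable_behead cg) => e' he'.
by exists (Sum e e') => W env /=; rewrite he (eq_bigr (fun _ => g W env)) ?sum_nat_const_nat ?subn0.
Qed.

Lemma computable_inp : computable (fun W env => wI W (f W env)).
Proof. by case: cf => e he; exists (Inp e) => W env /=; rewrite he. Qed.

Lemma computable_tab : computable (fun W env => wT W (f W env)).
Proof. by case: cf => e he; exists (Tab e) => W env /=; rewrite he. Qed.

Lemma computable_nat_of_bool : computable (fun W env => nat_of_bool (a W env)).
Proof. exact: ca. Qed.

Lemma computable_if : computable (fun W env => if a W env then f W env else g W env).
Proof.
case: ca cf cg => [e0 h0] [e he] [e' he']; exists (If e0 e e') => W env /=.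
by rewrite h0 he he'; case: a.
Qed.

Lemma computableb_leq : computableb (fun W env => f W env <= g W env).
Proof.
case: cf cg => [e he] [e' he']; exists (If (Sub e e') (Cst 0) (Cst 1)) => W env /=.
by rewrite he he' subn_eq0; case: ifP.
Qed.

Lemma computableb_eqn : computableb (fun W env => f W env == g W env).
Proof.
case: cf cg => [e he] [e' he'].
exists (If (Add (Sub e e') (Sub e' e)) (Cst 0) (Cst 1)) => W env /=.
by rewrite he he' addn_eq0 !subn_eq0 -eqn_leq; case: eqP.
Qed.

Lemma computableb_neg : computableb (fun W env => ~~ a W env).
Proof. by case: ca => e he; exists (If e (Cst 0) (Cst 1)) => W env /=; rewrite he; case: a. Qed.

Lemma computableb_and : computableb (fun W env => a W env && b W env).
Proof.
case: ca cb => [e he] [e' he']; exists (If e e' (Cst 0)) => W env /=.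
by rewrite he he'; case: a.
Qed.

Lemma computableb_or : computableb (fun W env => a W env || b W env).
Proof.
case: ca cb => [e he] [e' he']; exists (If e (Cst 1) e') => W env /=.
by rewrite he he'; case: a.
Qed.

Lemma computableb_imp : computableb (fun W env => a W env ==> b W env).
Proof.
case: ca cb => [e he] [e' he']; exists (If e e' (Cst 1)) => W env /=.
by rewrite he he'; case: a.
Qed.

Lemma computableb_if d : computableb d -> computableb (fun W env => if a W env then b W env else d W env).
Proof.
case: ca cb => [e0 h0] [e he] [e' he']; exists (If e0 e e') => W env /=.
by rewrite h0 he he'; case: a.
Qed.

Lemma computableb_eqb : computableb (fun W env => a W env == b W env).
Proof.
case: ca cb => [e he] [e' he']; exists (If e e' (If e' (Cst 0) (Cst 1))) => W env /=.
by rewrite he he'; case: a; case: b.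
Qed.

End Closure.

Section Binders.
Variables (n z : world -> seq nat -> nat).
Hypotheses (cn : computable n) (cz : computable z).

Lemma computable_sum (F : world -> nat -> seq nat -> nat) :
  computable (fun W env => F W (head 0 env) (behead env)) ->
  computable (fun W env => \sum_(0 <= i < n W env) F W i env).
Proof.
case: cn => [e he] [e' he']; exists (Sum e e') => W env /=.
by rewrite he; apply: eq_bigr => i _; rewrite he'.
Qed.

Lemma computable_iter (F : world -> nat -> seq nat -> nat) :
  computable (fun W env => F W (head 0 env) (behead env)) ->
  computable (fun W env => iter (n W env) (fun v => minn (F W v env) (wL W)) (z W env)).
Proof.
case: cn cz => [e he] [e0 h0] [e' he']; exists (Iter e e0 e') => W env /=.
by rewrite he h0; apply: eq_iter => v; rewrite he'.
Qed.

Lemma computableb_has (F : world -> nat -> seq nat -> bool) :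
  computableb (fun W env => F W (head 0 env) (behead env)) ->
  computableb (fun W env => has (fun i => F W i env) (iota 0 (n W env))).
Proof.
move=> cF; apply: (@computableb_ext _ (fun W env =>
  1 <= \sum_(0 <= i < n W env) nat_of_bool (F W i env))).
  by apply: computableb_leq; [exact: computable_const | exact: computable_sum].
by move=> W env; rewrite has_count -sum1_count big_mkcond /index_iota subn0.
Qed.

Lemma computableb_all (F : world -> nat -> seq nat -> bool) :
  computableb (fun W env => F W (head 0 env) (behead env)) ->
  computableb (fun W env => all (fun i => F W i env) (iota 0 (n W env))).
Proof.
move=> cF; apply: (@computableb_ext _ (fun W env =>
   ~~ has (fun i => ~~ F W i env) (iota 0 (n W env)))).
  by apply: computableb_neg; apply: (@computableb_has (fun W i env => ~~ F W i env));
    exact: computableb_neg.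
by move=> W env; rewrite has_predC negbK.
Qed.

End Binders.

(** Here the list is a parameter of the procedure rather than part of the input, so the conjunction
    is unrolled into the expression. This handles the digit positions, whose number depends only on
    [k] and [w]. *)
Lemma computableb_all_seq (F : world -> seq nat -> nat -> bool) (s : seq nat) :
  (forall j, computableb (fun W env => F W env j)) ->
  computableb (fun W env => all (F W env) s).
Proof.
move=> cF; elim: s => [|j s IH] /=; first exact: (computable_const 1).
exact: computableb_and.
Qed.

Lemma computableb_has_seq (F : world -> seq nat -> nat -> bool) (s : seq nat) :
  (forall j, computableb (fun W env => F W env j)) ->
  computableb (fun W env => has (F W env) s).
Proof.
move=> cF; elim: s => [|j s IH] /=; first exact: (computable_const 0).
exact: computableb_or.
Qed.

Lemma computable_exp f n : computable f -> computable (fun W env => f W env ^ n).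
Proof.
move=> cf; elim: n => [|n IH]; first exact: computable_const.
apply: (computable_ext (computable_mul cf IH)) => W env; exact: expnS.
Qed.

(** The quotient is the number of positive multiples of [d] up to [x], and never exceeds [x]. The
    guard [0 < d] reproduces the convention that division by 0 gives 0. *)
Lemma divn_sum x d : x %/ d = \sum_(0 <= q < x) nat_of_bool ((0 < d) && (q.+1 * d <= x)).
Proof.
have [->|d_gt0] := posnP d; first by rewrite divn0 big1.
have le : x %/ d <= x by apply: leq_div.
rewrite (big_cat_nat (leq0n _) le) /= [X in _ + X]big_nat_cond [X in _ + X]big1 => [|q]; last first.
  by rewrite andbT -leq_divRL // => /andP[h _]; rewrite ltnNge h.
rewrite addn0 big_nat_cond (eq_bigr (fun _ => 1)) => [|q].
  by rewrite -big_nat_cond sum_nat_const_nat subn0 muln1.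
by rewrite andbT -leq_divRL // => /andP[_ ->].
Qed.

Lemma computable_div f g :
  computable f -> computable g -> computable (fun W env => f W env %/ g W env).
Proof.
move=> cf cg; apply: (computable_ext _ (fun W env => divn_sum _ _)).
apply: (@computable_sum f cf (fun W q env => nat_of_bool ((0 < g W env) && (q.+1 * g W env <= f W env)))).
apply: computableb_and; apply: computableb_leq.
- exact: computable_const.
- exact: computable_behead.
- by apply: computable_mul; [apply: computable_succ; exact: computable_head | exact: computable_behead].
- exact: computable_behead.
Qed.

Lemma computable_mod f g :
  computable f -> computable g -> computable (fun W env => f W env %% g W env).
Proof.
move=> cf cg; apply: (computable_ext (computable_sub cf (computable_mul (computable_div cf cg) cg))).
by move=> W env; rewrite {2}(divn_eq (f W env) (g W env)) addKn.
Qed.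

(** Reuses a fact about the outer environment under up to [n] binders, by iterating
    [computable_behead]. *)
Ltac weaken_exact t n :=
  first [ exact: t
        | lazymatch n with S ?n' => weaken_exact (computable_behead t) n' end ].

Ltac computable_leaf :=
  match goal with
  | |- computable (fun _ _ => head 0 _) => weaken_exact computable_head 8
  | |- _ => exact: computable_const
  | H : computable _ |- computable _ => weaken_exact H 8
  | H : computableb _ |- computableb _ => weaken_exact H 8
  end.

Create HintDb comp.
#[export] Hint Extern 9 (computable _) => computable_leaf : comp.
#[export] Hint Extern 9 (computableb _) => computable_leaf : comp.
#[export] Hint Extern 1 (computable (fun _ _ => _ + _)) => eapply computable_add : comp.
#[export] Hint Extern 1 (computable (fun _ _ => _ - _)) => eapply computable_sub : comp.
#[export] Hint Extern 1 (computable (fun _ _ => _ * _)) => eapply computable_mul : comp.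
#[export] Hint Extern 1 (computable (fun _ _ => _ %/ _)) => eapply computable_div : comp.
#[export] Hint Extern 1 (computable (fun _ _ => _ %% _)) => eapply computable_mod : comp.
#[export] Hint Extern 1 (computable (fun _ _ => _ ^ _)) => eapply computable_exp : comp.
#[export] Hint Extern 1 (computable (fun _ _ => _.+1)) => eapply computable_succ : comp.
#[export] Hint Extern 1 (computable (fun _ _ => _.-1)) => eapply computable_pred : comp.
#[export] Hint Extern 1 (computable (fun _ _ => wI _ _)) => eapply computable_inp : comp.
#[export] Hint Extern 1 (computable (fun _ _ => wT _ _)) => eapply computable_tab : comp.
#[export] Hint Extern 1 (computable (fun _ _ => nat_of_bool _)) =>
  eapply computable_nat_of_bool : comp.
#[export] Hint Extern 1 (computable (fun _ _ => if _ then _ else _)) => eapply computable_if : comp.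
#[export] Hint Extern 1 (computable (fun _ _ => \sum_(0 <= i < _) _)) =>
  eapply computable_sum; cbv beta : comp.
#[export] Hint Extern 1 (computable (fun _ _ => iter _ _ _)) =>
  eapply computable_iter; cbv beta : comp.
#[export] Hint Extern 1 (computableb (fun _ _ => _ <= _)) => eapply computableb_leq : comp.
#[export] Hint Extern 1 (computableb (fun _ _ => _ == _)) =>
  first [eapply computableb_eqn | eapply computableb_eqb] : comp.
#[export] Hint Extern 1 (computableb (fun _ _ => if _ then _ else _)) =>
  eapply computableb_if : comp.
#[export] Hint Extern 1 (computableb (fun _ _ => ~~ _)) => eapply computableb_neg : comp.
#[export] Hint Extern 1 (computableb (fun _ _ => _ && _)) => eapply computableb_and : comp.
#[export] Hint Extern 1 (computableb (fun _ _ => _ || _)) => eapply computableb_or : comp.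
#[export] Hint Extern 1 (computableb (fun _ _ => _ ==> _)) => eapply computableb_imp : comp.
#[export] Hint Extern 1 (computableb (fun _ _ => has _ (iota 0 _))) =>
  eapply computableb_has; cbv beta : comp.
#[export] Hint Extern 1 (computableb (fun _ _ => all _ (iota 0 _))) =>
  eapply computableb_all; cbv beta : comp.

Ltac comp := auto 100 with comp nocore.

(** * The decision procedure *)

Section Reader.
Variable W : world.

(* Position of the [j]-th of a series of length-prefixed lists that starts at [z]. *)
Definition list_pos z j := iter j (fun v => minn (v + 1 + wI W v) (wL W)) z.
Definition in_list p v := has (fun i => wI W (p + 1 + i) == v) (iota 0 (wI W p)).

Definition n_prop := wI W 0.
Definition n_act := wI W 1.
(** Two counts precede three lists per action, which explains the start 2 and the factor 3. The cell
    found holds the task count; after it come the labels, the flattened order, the initial state and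
    the goal. *)
Definition tail_pos := list_pos 2 (3 * n_act).
Definition n_task := wI W tail_pos.
Definition in_pre a f := in_list (list_pos 2 (3 * a)) f.
Definition in_del a f := in_list (list_pos 2 (3 * a + 1)) f.
Definition in_add a f := in_list (list_pos 2 (3 * a + 2)) f.
Definition label t := wI W (tail_pos + 2 + t).
Definition ord_pos := list_pos tail_pos.+1 1.
(** Pair [i] occupies entries [i + i] and [i + i + 1] of a flattened list. Instead of halving the
    length, [i] runs over all of it and the guard discards the excess. *)
Definition before t u :=
  has (fun i => [&& i + i + 1 < wI W ord_pos, wI W (ord_pos + 1 + (i + i)) == t &
                 wI W (ord_pos + 2 + (i + i)) == u]) (iota 0 (wI W ord_pos)).
Definition in_init f := in_list (list_pos tail_pos.+1 2) f.
Definition goal_pos := list_pos tail_pos.+1 3.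
Definition in_goal f := in_list goal_pos f.
Definition goal_count a := \sum_(0 <= i < wI W goal_pos) (wI W (goal_pos + 1 + i) == a).
End Reader.

Lemma computable_list_pos f g : computable f -> computable g ->
  computable (fun W env => list_pos W (f W env) (g W env)).
Proof. by move=> cf cg; rewrite /list_pos; comp. Qed.
#[export] Hint Extern 1 (computable (fun _ _ => list_pos _ _ _)) =>
  eapply computable_list_pos : comp.

Lemma computable_in_list f g : computable f -> computable g ->
  computableb (fun W env => in_list W (f W env) (g W env)).
Proof. by move=> cf cg; rewrite /in_list; comp. Qed.
#[export] Hint Extern 1 (computableb (fun _ _ => in_list _ _ _)) =>
  eapply computable_in_list : comp.

Section ComputableReader.
Variables f g : world -> seq nat -> nat.
Hypotheses (cf : computable f) (cg : computable g).

Lemma computable_n_prop : computable (fun W env => n_prop W).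
Proof. by rewrite /n_prop; comp. Qed.

Lemma computable_n_act : computable (fun W env => n_act W).
Proof. by rewrite /n_act; comp. Qed.

Hint Extern 1 (computable (fun _ _ => n_act _)) => eapply computable_n_act : comp.

Lemma computable_tail_pos : computable (fun W env => tail_pos W).
Proof. by rewrite /tail_pos; comp. Qed.

Hint Extern 1 (computable (fun _ _ => tail_pos _)) => eapply computable_tail_pos : comp.

Lemma computable_n_task : computable (fun W env => n_task W).
Proof. by rewrite /n_task; comp. Qed.

Lemma computable_label : computable (fun W env => label W (f W env)).
Proof. by rewrite /label; comp. Qed.

Lemma computable_in_pre : computableb (fun W env => in_pre W (f W env) (g W env)).
Proof. by rewrite /in_pre; comp. Qed.

Lemma computable_in_del : computableb (fun W env => in_del W (f W env) (g W env)).
Proof. by rewrite /in_del; comp. Qed.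

Lemma computable_in_add : computableb (fun W env => in_add W (f W env) (g W env)).
Proof. by rewrite /in_add; comp. Qed.

Lemma computable_before : computableb (fun W env => before W (f W env) (g W env)).
Proof. by rewrite /before /ord_pos; comp. Qed.

Lemma computable_in_init : computableb (fun W env => in_init W (f W env)).
Proof. by rewrite /in_init; comp. Qed.

Lemma computable_in_goal : computableb (fun W env => in_goal W (f W env)).
Proof. by rewrite /in_goal /goal_pos; comp. Qed.

Lemma computable_goal_count : computable (fun W env => goal_count W (f W env)).
Proof. by rewrite /goal_count /goal_pos; comp. Qed.

End ComputableReader.

#[export] Hint Extern 1 (computable (fun _ _ => n_prop _)) => eapply computable_n_prop : comp.
#[export] Hint Extern 1 (computable (fun _ _ => n_act _)) => eapply computable_n_act : comp.
#[export] Hint Extern 1 (computable (fun _ _ => n_task _)) => eapply computable_n_task : comp.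
#[export] Hint Extern 1 (computable (fun _ _ => label _ _)) => eapply computable_label : comp.
#[export] Hint Extern 1 (computableb (fun _ _ => in_pre _ _ _)) => eapply computable_in_pre : comp.
#[export] Hint Extern 1 (computableb (fun _ _ => in_del _ _ _)) => eapply computable_in_del : comp.
#[export] Hint Extern 1 (computableb (fun _ _ => in_add _ _ _)) => eapply computable_in_add : comp.
#[export] Hint Extern 1 (computableb (fun _ _ => before _ _ _)) => eapply computable_before : comp.
#[export] Hint Extern 1 (computableb (fun _ _ => in_init _ _)) => eapply computable_in_init : comp.
#[export] Hint Extern 1 (computableb (fun _ _ => in_goal _ _)) => eapply computable_in_goal : comp.
#[export] Hint Extern 1 (computable (fun _ _ => goal_count _ _)) =>
  eapply computable_goal_count : comp.

(* A configuration of a run is coded by a number written in base [base]: [k]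
   digits are actions that lead from the initial state to the current one ([0]
   is a no-op, [a.+1] stands for [a]), [w] digits generate the down-set of the
   executed non-isolated tasks ([0] is void, [t.+1] stands for [t]), [K] digits
   count the executed isolated tasks of each behaviour class, and the remaining
   quotient is the number of executed tasks. *)
Section Procedure.
Variables (k w K : nat) (W : world).

Definition base := n_act W + n_task W + 1.
Definition digit i x := (x %/ base ^ i) %% base.

(** A state is not a value of the expression language, so membership is computed for one proposition
    at a time. Preconditions are left to [valid]. *)
Fixpoint holds j x f :=
  if j is j'.+1 then
    if digit j' x == 0 then holds j' x f
    else in_add W (digit j' x).-1 f || holds j' x f && ~~ in_del W (digit j' x).-1 f
  else in_init W f.

Fixpoint valid j x :=
  if j is j'.+1 then
    valid j' x && ((digit j' x == 0) || (digit j' x <= n_act W) &&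
      all (fun f => in_pre W (digit j' x).-1 f ==> holds j' x f) (iota 0 (n_prop W)))
  else true.

Definition applies x a := all (fun f => in_pre W a f ==> holds k x f) (iota 0 (n_prop W)).
Definition holds_after x a f := in_add W a f || holds k x f && ~~ in_del W a f.

Definition similar a b :=
  all (fun c => valid k c ==> (applies c a == applies c b) &&
    (applies c a ==> all (fun f => holds_after c a f == holds_after c b f) (iota 0 (n_prop W))))
  (iota 0 (base ^ k)).

Definition leader b := all (fun c => ~~ similar c b) (iota 0 b).

(** The rank of the class: leaders strictly below every action similar to [a] are the leaders
    preceding its own. A rank, unlike the leader itself, is bounded independently of the number of
    actions, so that [K] counters suffice. *)
Definition class a :=
  \sum_(0 <= b < n_act W) (leader b && all (fun c => similar c a ==> (b < c)) (iota 0 (n_act W))).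

Definition lonely t :=
  all (fun u => (u == t) || ~~ before W t u && ~~ before W u t) (iota 0 (n_task W)).

Definition generated x t :=
  has (fun i => (digit i x != 0) && (((digit i x).-1 == t) || before W t (digit i x).-1)) (iota k w).

Definition executed x t := ~~ lonely t && generated x t.
Definition count_of j x := digit (k + w + j) x.
Definition time x := x %/ base ^ (k + w + K).
Definition class_size j := \sum_(0 <= t < n_task W) (lonely t && (class (label W t) == j)).

Definition linked_step y x t :=
  [&& ~~ lonely t, ~~ executed y t, all (fun u => before W u t ==> executed y u) (iota 0 (n_task W)),
      all (fun j => count_of j x == count_of j y) (iota 0 K) &
      all (fun u => executed x u == executed y u || (u == t)) (iota 0 (n_task W))].

(** [t] merely stands for its class: a code does not record which isolated tasks have run, so the
    test is that the counter stays within the class size and not that [t] is new. *)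
Definition lonely_step y x t :=
  [&& lonely t,
      all (fun j => (count_of j x == count_of j y + (class (label W t) == j)) &&
                    (count_of j x <= class_size j)) (iota 0 K) &
      all (fun u => executed x u == executed y u) (iota 0 (n_task W))].

Definition one_step y x := has (fun t =>
  [&& applies y (label W t),
      all (fun f => holds k x f == holds_after y (label W t) f) (iota 0 (n_prop W)) &
      linked_step y x t || lonely_step y x t]) (iota 0 (n_task W)).

Definition start x :=
  [&& time x == 0, all (fun f => holds k x f == in_init W f) (iota 0 (n_prop W)),
      all (fun u => ~~ executed x u) (iota 0 (n_task W)) &
      all (fun j => count_of j x == 0) (iota 0 K)].

(** Searching only below [x] loses nothing: the time is the leading part of a code, so a
    predecessor, being one step earlier, is a smaller number. *)
Definition entry x :=
  valid k x && (start x ||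
    has (fun y => [&& wT W y != 0, (time y).+1 == time x & one_step y x]) (iota 0 x)).

Definition table_size := (n_task W).+1 * base ^ (k + w + K).

Definition reach_answer := has (fun x => (wT W x != 0) &&
  all (fun f => in_goal W f ==> holds k x f) (iota 0 (n_prop W))) (iota 0 table_size).

(** The occurrences of [a] left to the isolated tasks, the executed non-isolated ones being
    determined by the code. *)
Definition need x a :=
  goal_count W a - \sum_(0 <= t < n_task W) (executed x t && (label W t == a)).

(** Both conditions are necessary, and together they suffice: choose [need] isolated tasks for each
    action, then complete each class arbitrarily to its counter; some run executes exactly this
    choice. *)
Definition exec_answer := has (fun x => [&& wT W x != 0,
  all (fun a => need x a <= \sum_(0 <= t < n_task W) (lonely t && (label W t == a)))
    (iota 0 (n_act W)) &
  all (fun j => \sum_(0 <= a < n_act W) (class a == j) * need x a <= count_of j x) (iota 0 K)])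
  (iota 0 table_size).

End Procedure.

(** * The procedure is given by expressions *)

Section ComputableProcedure.
Variables (k w K : nat) (f g h : world -> seq nat -> nat).
Hypotheses (cf : computable f) (cg : computable g) (ch : computable h).

Lemma computable_base : computable (fun W env => base W).
Proof. by rewrite /base; comp. Qed.
#[local] Hint Extern 1 (computable (fun _ _ => base _)) => eapply computable_base : comp.

Lemma computable_digit i : computable (fun W env => digit W i (f W env)).
Proof. by rewrite /digit; comp. Qed.

End ComputableProcedure.
#[export] Hint Extern 1 (computable (fun _ _ => base _)) => eapply computable_base : comp.
#[export] Hint Extern 1 (computable (fun _ _ => digit _ _ _)) => eapply computable_digit : comp.

Lemma computable_holds j f g : computable f -> computable g ->
  computableb (fun W env => holds W j (f W env) (g W env)).
Proof.
by move=> cf cg; elim: j => [|j IH] /=; comp.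
Qed.
#[export] Hint Extern 1 (computableb (fun _ _ => holds _ _ _ _)) => eapply computable_holds : comp.

Lemma computable_valid j f : computable f -> computableb (fun W env => valid W j (f W env)).
Proof. by move=> cf; elim: j => [|j IH] /=; [exact: (computable_const 1) | comp]. Qed.
#[export] Hint Extern 1 (computableb (fun _ _ => valid _ _ _)) => eapply computable_valid : comp.

Section ComputableProcedure.
Variables (k w K : nat) (f g h : world -> seq nat -> nat).
Hypotheses (cf : computable f) (cg : computable g) (ch : computable h).

Lemma computable_applies : computableb (fun W env => applies k W (f W env) (g W env)).
Proof. by rewrite /applies; comp. Qed.
Hint Extern 1 (computableb (fun _ _ => applies _ _ _ _)) => eapply computable_applies : comp.

Lemma computable_holds_after :
  computableb (fun W env => holds_after k W (f W env) (g W env) (h W env)).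
Proof. by rewrite /holds_after; comp. Qed.

End ComputableProcedure.
#[export] Hint Extern 1 (computableb (fun _ _ => applies _ _ _ _)) =>
  eapply computable_applies : comp.
#[export] Hint Extern 1 (computableb (fun _ _ => holds_after _ _ _ _ _)) =>
  eapply computable_holds_after : comp.

Lemma computable_similar k f g : computable f -> computable g ->
  computableb (fun W env => similar k W (f W env) (g W env)).
Proof. by move=> cf cg; rewrite /similar; comp. Qed.
#[export] Hint Extern 1 (computableb (fun _ _ => similar _ _ _ _)) =>
  eapply computable_similar : comp.

Lemma computable_leader k f : computable f -> computableb (fun W env => leader k W (f W env)).
Proof. by move=> cf; rewrite /leader; comp. Qed.
#[export] Hint Extern 1 (computableb (fun _ _ => leader _ _ _)) =>
  eapply computable_leader : comp.

Lemma computable_class k f : computable f -> computable (fun W env => class k W (f W env)).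
Proof. by move=> cf; rewrite /class; comp. Qed.
#[export] Hint Extern 1 (computable (fun _ _ => class _ _ _)) =>
  eapply computable_class : comp.

Lemma computable_lonely f : computable f -> computableb (fun W env => lonely W (f W env)).
Proof. by move=> cf; rewrite /lonely; comp. Qed.
#[export] Hint Extern 1 (computableb (fun _ _ => lonely _ _)) =>
  eapply computable_lonely : comp.

Lemma computable_executed k w f g : computable f -> computable g ->
  computableb (fun W env => executed k w W (f W env) (g W env)).
Proof.
move=> cf cg; rewrite /executed; apply: computableb_and; first by comp.
by apply: computableb_has_seq => i; comp.
Qed.
#[export] Hint Extern 1 (computableb (fun _ _ => executed _ _ _ _ _)) =>
  eapply computable_executed : comp.

Lemma computable_class_size k f :
  computable f -> computable (fun W env => class_size k W (f W env)).
Proof. by move=> cf; rewrite /class_size; comp. Qed.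
#[export] Hint Extern 1 (computable (fun _ _ => class_size _ _ _)) =>
  eapply computable_class_size : comp.

Lemma computable_linked_step k w K f g h : computable f -> computable g -> computable h ->
  computableb (fun W env => linked_step k w K W (f W env) (g W env) (h W env)).
Proof.
move=> cf cg ch; rewrite /linked_step /count_of; do 3!(apply: computableb_and; first by comp).
by apply: computableb_and; [apply: computableb_all_seq => j|]; comp.
Qed.
#[export] Hint Extern 1 (computableb (fun _ _ => linked_step _ _ _ _ _ _ _)) =>
  eapply computable_linked_step : comp.

Lemma computable_lonely_step k w K f g h : computable f -> computable g -> computable h ->
  computableb (fun W env => lonely_step k w K W (f W env) (g W env) (h W env)).
Proof.
move=> cf cg ch; rewrite /lonely_step /count_of.
apply: computableb_and; first by comp.
by apply: computableb_and; [apply: computableb_all_seq => j|]; comp.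
Qed.
#[export] Hint Extern 1 (computableb (fun _ _ => lonely_step _ _ _ _ _ _ _)) =>
  eapply computable_lonely_step : comp.

Lemma computable_one_step k w K f g : computable f -> computable g ->
  computableb (fun W env => one_step k w K W (f W env) (g W env)).
Proof. by move=> cf cg; rewrite /one_step; comp. Qed.
#[export] Hint Extern 1 (computableb (fun _ _ => one_step _ _ _ _ _ _)) =>
  eapply computable_one_step : comp.

Lemma computable_start k w K f : computable f ->
  computableb (fun W env => start k w K W (f W env)).
Proof.
move=> cf; rewrite /start /time /count_of; do 3!(apply: computableb_and; first by comp).
by apply: computableb_all_seq => j; comp.
Qed.
#[export] Hint Extern 1 (computableb (fun _ _ => start _ _ _ _ _)) =>
  eapply computable_start : comp.

Lemma computable_entry k w K f : computable f ->
  computableb (fun W env => entry k w K W (f W env)).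
Proof. by move=> cf; rewrite /entry /time; comp. Qed.

Lemma computable_table_size k w K : computable (fun W env => table_size k w K W).
Proof. by rewrite /table_size; comp. Qed.
#[export] Hint Extern 1 (computable (fun _ _ => table_size _ _ _ _)) =>
  eapply computable_table_size : comp.

Lemma computable_reach_answer k w K : computableb (fun W env => reach_answer k w K W).
Proof. by rewrite /reach_answer; comp. Qed.

Lemma computable_need k w f g : computable f -> computable g ->
  computable (fun W env => need k w W (f W env) (g W env)).
Proof. by move=> cf cg; rewrite /need; comp. Qed.
#[export] Hint Extern 1 (computable (fun _ _ => need _ _ _ _ _)) =>
  eapply computable_need : comp.

Lemma computable_exec_answer k w K : computableb (fun W env => exec_answer k w K W).
Proof.
rewrite /exec_answer; eapply computableb_has; cbv beta; first by comp.
apply: computableb_and; first by comp.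
apply: computableb_and; first by comp.
by apply: computableb_all_seq => j; rewrite /count_of; comp.
Qed.

(** * Reading the encoding *)

Section ReadLists.
Variables (W : world) (x pre : seq nat) (ls : seq (seq nat)) (post : seq nat).
Hypothesis x_def : x = pre ++ flatten (map enc_list ls) ++ post.
Hypothesis WI : wI W =1 nth 0 x.
Hypothesis WL : size x <= wL W.

Let offset j := size pre + size (flatten (map enc_list (take j ls))).

Lemma nth_offset j i : j < size ls -> i <= size (nth [::] ls j) ->
  nth 0 x (offset j + i) = nth 0 (enc_list (nth [::] ls j)) i.
Proof.
move=> ltj lei; rewrite x_def -{1}(cat_take_drop j ls) (drop_nth [::] ltj).
rewrite map_cat flatten_cat /= nth_cat ltnNge /offset -addnA leq_addr /= addKn.
by rewrite -!catA nth_cat ltnNge leq_addr /= addKn; case: i lei => //= i lei;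
  rewrite -catA nth_cat lei.
Qed.

(** The cutoff of the iteration never acts, since every list position is at most
    [size x <= wL W]. *)
Lemma list_pos_offset j : j <= size ls -> list_pos W (size pre) j = offset j.
Proof.
elim: j => [|j IH] ltj; first by rewrite /offset take0 addn0.
rewrite /list_pos iterS -/(list_pos W (size pre) j) IH ?(ltnW ltj) // WI.
have -> : nth 0 x (offset j) = size (nth [::] ls j) by rewrite -[offset j]addn0 nth_offset.
have E : offset j.+1 = offset j + 1 + size (nth [::] ls j).
  by rewrite /offset (take_nth [::] ltj) map_rcons flatten_rcons size_cat /=; lia.
rewrite -E; apply/minn_idPl; apply: leq_trans WL.
rewrite x_def /offset -{2}(cat_take_drop j.+1 ls) map_cat flatten_cat !size_cat; lia.
Qed.

Lemma read_size j : j < size ls -> wI W (list_pos W (size pre) j) = size (nth [::] ls j).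
Proof. by move=> ltj; rewrite list_pos_offset ?(ltnW ltj) // WI -[offset j]addn0 nth_offset. Qed.

Lemma read_nth j i : j < size ls -> i < size (nth [::] ls j) ->
  wI W (list_pos W (size pre) j + 1 + i) = nth 0 (nth [::] ls j) i.
Proof.
by move=> ltj lti; rewrite list_pos_offset ?(ltnW ltj) // WI -addnA nth_offset ?add1n.
Qed.

Lemma in_list_read j v : j < size ls ->
  in_list W (list_pos W (size pre) j) v = (v \in nth [::] ls j).
Proof.
move=> ltj; rewrite /in_list read_size //; apply/hasP/(nthP 0) => [[i]|[i lti <-]].
  by rewrite mem_iota add0n /= => lti /eqP <-; exists i; rewrite ?read_nth.
by exists i; rewrite ?mem_iota // read_nth.
Qed.

End ReadLists.

Definition act_lists (acts : seq (seq nat * seq nat * seq nat)) : seq (seq nat) :=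
  flatten [seq [:: y.1.1; y.1.2; y.2] | y <- acts].

Lemma size_act_lists acts : size (act_lists acts) = 3 * size acts.
Proof. by elim: acts => //= y acts; rewrite /act_lists /= => ->; lia. Qed.

Lemma nth_act_lists acts a q : a < size acts -> q < 3 ->
  nth [::] (act_lists acts) (3 * a + q) =
  nth [::] (let y := nth ([::], [::], [::]) acts a in [:: y.1.1; y.1.2; y.2]) q.
Proof.
move=> + ltq; elim: acts a => [|y acts IH] [|a] // lta.
  by case: q ltq {IH} => [|[|[|]]].
have -> : 3 * a.+1 + q = (3 * a + q).+3 by lia.
exact: IH.
Qed.

Lemma enc_acts acts :
  flatten [seq (let '(p, d, e) := y in enc_list p ++ enc_list d ++ enc_list e) | y <- acts] =
  flatten (map enc_list (act_lists acts)).
Proof. by elim: acts => [|[[p d] e] acts IH] //; rewrite /act_lists /= IH -!catA /= -!catA. Qed.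

Lemma nth_flatten_pairs (s : seq (nat * nat)) i : i < size s ->
  let l := flatten [seq [:: pr.1; pr.2] | pr <- s] in
  nth 0 l (i + i) = (nth (0, 0) s i).1 /\ nth 0 l (i + i).+1 = (nth (0, 0) s i).2.
Proof. by elim: s i => [|y s IH] [|i] //= lti; rewrite addnS; apply: IH. Qed.

Lemma size_flatten_pairs (s : seq (nat * nat)) :
  size (flatten [seq [:: pr.1; pr.2] | pr <- s]) = size s + size s.
Proof. by elim: s => //= y s ->; lia. Qed.

Section ReadInstance.
Variables (I : htn_inst) (G : seq nat) (W : world).
Hypothesis wf : wf_inst I.
Let x := enc_inst I ++ enc_list G.
Hypothesis WI : wI W =1 nth 0 x.
Hypothesis WL : size x <= wL W.

Let pre := [:: nF I; size (acts I)].
Let tail_lists := [:: lab I; flatten [seq [:: pr.1; pr.2] | pr <- ord I]; init I; G].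
Let pre2 := pre ++ flatten (map enc_list (act_lists (acts I))) ++ [:: nT I].

Lemma x_acts : x = pre ++ flatten (map enc_list (act_lists (acts I))) ++
  (nT I :: flatten (map enc_list tail_lists)).
Proof. by rewrite /x /enc_inst enc_acts /= cats0 -!catA /= -!catA /= -!catA. Qed.

Lemma x_tail : x = pre2 ++ flatten (map enc_list tail_lists) ++ [::].
Proof. by rewrite x_acts /pre2 cats0 -!catA. Qed.

Lemma read_n_prop : n_prop W = nF I. Proof. by rewrite /n_prop WI. Qed.
Lemma read_n_act : n_act W = size (acts I). Proof. by rewrite /n_act WI. Qed.

Lemma read_tail_pos : (tail_pos W).+1 = size pre2.
Proof.
rewrite /tail_pos read_n_act -size_act_lists (list_pos_offset x_acts WI WL) //.
by rewrite take_size /pre2 !size_cat /=; lia.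
Qed.

Lemma read_n_task : n_task W = nT I.
Proof.
rewrite /n_task WI x_acts; have := read_tail_pos; rewrite /pre2 catA size_cat addn1 => -[->].
by rewrite catA nth_cat ltnn subnn.
Qed.

Section Action.
Variables (a f : nat).
Hypothesis lt_a : a < size (acts I).

Lemma read_pre : in_pre W a f = (f \in (act_of I a).1.1).
Proof.
rewrite /in_pre (in_list_read x_acts WI WL) ?size_act_lists; last by lia.
by rewrite -[3 * a]addn0 nth_act_lists.
Qed.

Lemma read_del : in_del W a f = (f \in (act_of I a).1.2).
Proof.
rewrite /in_del (in_list_read x_acts WI WL) ?size_act_lists; last by lia.
by rewrite nth_act_lists.
Qed.

Lemma read_add : in_add W a f = (f \in (act_of I a).2).
Proof.
rewrite /in_add (in_list_read x_acts WI WL) ?size_act_lists; last by lia.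
by rewrite nth_act_lists.
Qed.
End Action.

Lemma read_label t : t < nT I -> label W t = nth 0 (lab I) t.
Proof.
case: wf => _ [szl _] ltt; rewrite /label.
have <- : wI W (size pre2 + 1 + t) = nth 0 (lab I) t.
  by apply: (read_nth x_tail WI WL (j := 0)) => //; rewrite /= szl.
by rewrite -read_tail_pos; congr wI; lia.
Qed.

Lemma read_before t u : before W t u = ((t, u) \in ord I).
Proof.
have sz : wI W (list_pos W (size pre2) 1) = size (ord I) + size (ord I).
  by rewrite (read_size x_tail WI WL (j := 1)) // -size_flatten_pairs.
rewrite /before /ord_pos read_tail_pos sz.
have rd i : i < size (ord I) + size (ord I) ->
  wI W (list_pos W (size pre2) 1 + 1 + i) =
  nth 0 (flatten [seq [:: pr.1; pr.2] | pr <- ord I]) i.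
  by rewrite -size_flatten_pairs => lti; rewrite (read_nth x_tail WI WL (j := 1)).
apply/hasP/(nthP (0, 0)) => [[i _]|[i lti E]].
  case/and3P=> lti; have lti' : i < size (ord I) by lia.
  have [E1 E2] := nth_flatten_pairs lti'.
  have -> : forall p, p + 2 + (i + i) = p + 1 + (i + i).+1 by lia.
  rewrite !rd ?E1 ?E2; try lia.
  move=> /eqP <- /eqP <-; exists i => //; by case: nth.
have [E1 E2] := nth_flatten_pairs lti; have {}lti : i < size (ord I) := lti.
exists i; first by rewrite mem_iota; lia.
have -> : forall p, p + 2 + (i + i) = p + 1 + (i + i).+1 by lia.
by rewrite !rd ?E1 ?E2 ?E ?eqxx ?andbT; lia.
Qed.

Lemma read_init f : in_init W f = (f \in init I).
Proof. by rewrite /in_init read_tail_pos (in_list_read x_tail WI WL). Qed.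

Lemma read_goal f : in_goal W f = (f \in G).
Proof. by rewrite /in_goal /goal_pos read_tail_pos (in_list_read x_tail WI WL). Qed.

Lemma read_goal_count a : goal_count W a = count_mem a G.
Proof.
have sz : wI W (list_pos W (size pre2) 3) = size G by rewrite (read_size x_tail WI WL).
rewrite /goal_count /goal_pos read_tail_pos sz.
transitivity (\sum_(0 <= i < size G) (nth 0 G i == a)).
  rewrite big_nat [RHS]big_nat; apply: eq_bigr => i /andP[_ lti].
  by rewrite (read_nth x_tail WI WL (j := 3)).
by rewrite -sum1_count [RHS]big_mkcond [RHS](big_nth 0); apply: eq_bigr => i _ /=; case: eqP.
Qed.

End ReadInstance.

(** * Reachable states *)

Section States.
Variables (I : htn_inst) (k : nat).
Hypothesis few_states : nstates_le I k.

Lemma exec_seq_rcons (s : state I) l a :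
  exec_seq I s (rcons l a) = obind (exec_act I a) (exec_seq I s l).
Proof. by rewrite /exec_seq foldl_rcons. Qed.

Definition succ_state : rel (state I) :=
  fun s s' => [exists a : 'I_(size (acts I)), exec_act I a s == Some s'].

Lemma reachable_s0 : reachable I (s0 I).
Proof. by exists [::]. Qed.

Lemma reachable_exec s a s' : a < size (acts I) ->
  reachable I s -> exec_act I a s = Some s' -> reachable I s'.
Proof.
move=> lta [l [hl El]] Ea; exists (rcons l a).
by rewrite all_rcons lta hl exec_seq_rcons El.
Qed.

Lemma path_actions s p : path succ_state s p ->
  exists l, [/\ size l = size p, all (fun a => a < size (acts I)) l &
    exec_seq I s l = Some (last s p)].
Proof.
elim/last_ind: p => [|p s' IH]; first by exists [::].
rewrite rcons_path last_rcons => /andP[/IH[l [szl hl El]] /existsP[a /eqP Ea]].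
exists (rcons l a); rewrite !size_rcons szl all_rcons hl ltn_ord; split=> //.
by rewrite exec_seq_rcons El.
Qed.

Lemma reachableP s : reachable I s <-> connect succ_state (s0 I) s.
Proof.
split=> [[l [hl El]]|/connectP[p /path_actions[l [_ hl El]] ->]]; last by exists l.
elim/last_ind: l s hl El => [|l a IH] s.
  by move=> _ [<-]; apply: connect0.
rewrite all_rcons exec_seq_rcons => /andP[lta hl].
case E: (exec_seq _ _ _) => [s'|] //= Ea.
apply: connect_trans (IH _ hl E) (connect1 _).
by apply/existsP; exists (Ordinal lta); rewrite Ea.
Qed.

(* A simple path visits at most [k] states, hence uses fewer than [k] actions. *)
Lemma reachable_short s : reachable I s ->
  exists l, [/\ size l <= k, all (fun a => a < size (acts I)) l &
    exec_seq I (s0 I) l = Some s].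
Proof.
move=> /reachableP/connectP[p0 /shortenP[p hp up _] ->].
have [l [szl hl El]] := path_actions hp.
exists l; split=> //; rewrite szl.
apply: leq_trans (few_states up _) => //.
move=> s' /= s'p; apply/reachableP; apply: path_connect hp _ _.
exact: s'p.
Qed.

Definition states : seq (state I) := [seq s <- enum {set 'I_(nF I)} | connect succ_state (s0 I) s].

Lemma mem_states s : (s \in states) = connect succ_state (s0 I) s.
Proof. by rewrite mem_filter mem_enum andbT. Qed.

Lemma size_states : size states <= k.
Proof.
apply: few_states; first by rewrite filter_uniq ?enum_uniq.
by move=> s; rewrite mem_states => /reachableP.
Qed.

Definition same_effect a b := forall s, reachable I s -> exec_act I a s = exec_act I b s.

(** An action as a partial map on the reachable states, [ord_max] marking states where it is not
    executable; this is the origin of [k.+1 ^ k]. Indices past the end of [states] are evaluated at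
    [s0 I], which is harmless. *)
Definition behaviour a : {ffun 'I_k -> 'I_k.+1} :=
  [ffun i : 'I_k => if exec_act I a (nth (s0 I) states i) is Some s then inord (index s states)
                    else ord_max].

(** Successors of reachable states under actual actions are reachable, so their index is below [k]
    and cannot be confused with [ord_max]. *)
Lemma behaviour_inj a b : a < size (acts I) -> b < size (acts I) ->
  behaviour a = behaviour b -> same_effect a b.
Proof.
move=> lta ltb /ffunP E s hs.
have s_in : s \in states by rewrite mem_states; apply/reachableP.
have lti : index s states < k by rewrite (leq_trans _ size_states) ?index_mem.
have := E (Ordinal lti); rewrite !ffunE /= nth_index //.
have idx c s' : c < size (acts I) -> exec_act I c s = Some s' ->
    s' \in states /\ index s' states < k.
  move=> ltc Ec; have s'_in : s' \in states.
    by rewrite mem_states; apply/reachableP; apply: reachable_exec Ec.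
  by rewrite s'_in (leq_trans _ size_states) ?index_mem.
case Ea: exec_act => [s1|]; case Eb: exec_act => [s2|] //.
- have [i1 l1] := idx _ _ lta Ea; have [i2 l2] := idx _ _ ltb Eb.
  move=> /(congr1 val); rewrite /= !inordK ?(leqW l1) ?(leqW l2) //.
  by move=> /(congr1 (nth (s0 I) states)); rewrite !nth_index // => ->.
- have [i1 l1] := idx _ _ lta Ea.
  by move=> /(congr1 val); rewrite /= inordK ?(leqW l1) // => E1; rewrite E1 ltnn in l1.
- have [i1 l1] := idx _ _ ltb Eb.
  by move=> /(congr1 val); rewrite /= inordK ?(leqW l1) // => E1; rewrite -E1 ltnn in l1.
Qed.

Lemma distinct_effects (S : seq nat) : uniq S -> all (fun a => a < size (acts I)) S ->
  (forall a b, a \in S -> b \in S -> same_effect a b -> a = b) -> size S <= k.+1 ^ k.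
Proof.
move=> uS /allP hS inj.
have <- : #|{ffun 'I_k -> 'I_k.+1}| = k.+1 ^ k by rewrite card_ffun !card_ord.
rewrite -(size_map behaviour).
have /card_uniqP <- : uniq (map behaviour S); last by apply: max_card.
by rewrite map_inj_in_uniq // => a b ha hb /behaviour_inj h; apply: inj => //; apply: h; apply: hS.
Qed.

End States.

(** * Decoding configurations *)

Lemma all_iotaP (p : nat -> bool) n : reflect (forall i, i < n -> p i) (all p (iota 0 n)).
Proof.
by apply: (iffP allP) => h i; [move=> lt; apply: h; rewrite mem_iota | rewrite mem_iota => /h].
Qed.

Lemma has_iotaP (p : nat -> bool) n : reflect (exists2 i, i < n & p i) (has p (iota 0 n)).
Proof.
by apply: (iffP hasP) => -[i]; [rewrite mem_iota | move=> lt]; exists i; rewrite ?mem_iota.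
Qed.

Lemma all_iota_ordP n (p : nat -> bool) : reflect (forall i : 'I_n, p i) (all p (iota 0 n)).
Proof.
by apply: (iffP (all_iotaP _ _)) => h i; [exact: h | move=> lt; exact: (h (Ordinal lt))].
Qed.

Section Digits.
Variable W : world.

(** The induction merges the top digit into the quotient; the quotient that remains free will hold
    the time. *)
Lemma digits_exist n (d : nat -> nat) q : (forall i, i < n -> d i < base W) ->
  exists x, (forall i, i < n -> digit W i x = d i) /\ x %/ base W ^ n = q.
Proof.
have b_gt0 : 0 < base W by rewrite /base addn1.
elim: n q => [|n IH] q hd; first by exists q; rewrite divn1.
have [|x [hx qx]] := IH (q * base W + d n); first by move=> i lt; apply: hd; apply: ltnW.
exists x; split=> [i|]; last first.
  by rewrite expnSr divnMA qx divnMDl // divn_small ?addn0 // hd.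
rewrite ltnS leq_eqVlt => /predU1P[->|/hx //].
by rewrite /digit qx modnMDl modn_small // hd.
Qed.

End Digits.

Section Decode.
Variables (k w K : nat) (I : htn_inst) (W : world).
Hypotheses (rF : n_prop W = nF I) (rA : n_act W = size (acts I)) (rT : n_task W = nT I).
Hypotheses
  (rpre : forall a f, a < size (acts I) -> in_pre W a f = (f \in (act_of I a).1.1))
  (rdel : forall a f, a < size (acts I) -> in_del W a f = (f \in (act_of I a).1.2))
  (radd : forall a f, a < size (acts I) -> in_add W a f = (f \in (act_of I a).2))
  (rinit : forall f, in_init W f = (f \in init I)).

Definition state_of j x : state I := [set f : 'I_(nF I) | holds W j x f].
Definition state_after x a : state I := [set f : 'I_(nF I) | holds_after k W x a f].

Lemma exec_act_state j x a : a < size (acts I) ->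
  exec_act I a (state_of j x) =
  if all (fun f => in_pre W a f ==> holds W j x f) (iota 0 (n_prop W)) then
    Some [set f : 'I_(nF I) | in_add W a f || holds W j x f && ~~ in_del W a f]
  else None.
Proof.
move=> lta; rewrite /exec_act rF.
have -> : (pre_a I a \subset state_of j x) =
    all (fun f => in_pre W a f ==> holds W j x f) (iota 0 (nF I)).
  apply/subsetP/all_iota_ordP => h f.
    by apply/implyP => hf; have := h f; rewrite !inE rpre // in hf * => /(_ hf).
  by have /implyP := h f; rewrite !inE rpre.
case: ifP => // _; congr Some; apply/setP => f.
by rewrite !inE radd // rdel // orbC andbC.
Qed.

Lemma exec_act_code x a : a < size (acts I) ->
  exec_act I a (state_of k x) = if applies k W x a then Some (state_after x a) else None.
Proof. exact: exec_act_state. Qed.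

Lemma state_of0 x : state_of 0 x = s0 I.
Proof. by apply/setP => f; rewrite !inE /= rinit. Qed.

Lemma state_eqP j x (p : nat -> bool) :
  reflect (state_of j x = [set f : 'I_(nF I) | p f])
    (all (fun f => holds W j x f == p f) (iota 0 (n_prop W))).
Proof.
rewrite rF; apply: (iffP (all_iota_ordP _ _)) => h; first by apply/setP => f; rewrite !inE (eqP (h f)).
by move=> f; move/setP: h => /(_ f); rewrite !inE => ->.
Qed.

Lemma state_ofS j x : valid W j.+1 x ->
  valid W j x /\
  if digit W j x == 0 then state_of j.+1 x = state_of j x else
  (digit W j x).-1 < size (acts I) /\
  exec_act I (digit W j x).-1 (state_of j x) = Some (state_of j.+1 x).
Proof.
rewrite /= => /andP[hv h]; split=> //.
case: ifP h => [d0 _|d0 /=]; first by apply/setP => f; rewrite !inE /= d0.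
rewrite rA => /andP[le ha].
have lt : (digit W j x).-1 < size (acts I) by move: d0 le; case: digit.
split=> //; rewrite exec_act_state // ha; congr Some.
by apply/setP => f; rewrite !inE /= d0.
Qed.

Lemma valid_reachable j x : valid W j x -> reachable I (state_of j x).
Proof.
elim: j => [|j IH] hv; first by rewrite state_of0; exact: reachable_s0.
have [/IH hr] := state_ofS hv; case: ifP => [_ -> //|_ [lt E]].
exact: reachable_exec lt hr E.
Qed.

Hypothesis few_states : nstates_le I k.

(** A shortest action word is padded with the no-op 0 to [k] digits. Quantifying over every [x] with
    these digits lets the remaining digits be chosen independently. *)
Lemma code_of_state s : reachable I s ->
  exists d, (forall i, d i <= size (acts I)) /\
    forall x, (forall i, i < k -> digit W i x = d i) -> valid W k x /\ state_of k x = s.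
Proof.
move=> /(reachable_short few_states)[l [szl /(all_nthP 0) hl El]].
exists (fun i => if i < size l then (nth 0 l i).+1 else 0); split=> [i|x hx].
  by case: ifP => // /hl.
suff H j : j <= k -> valid W j x /\ exec_seq I (s0 I) (take j l) = Some (state_of j x).
  by have [hv] := H k (leqnn k); rewrite take_oversize // El => -[->].
elim: j => [|j IH] ltj; first by rewrite take0 state_of0.
have [hv E] := IH (ltnW ltj); rewrite /= hv /= hx //.
case: (ltnP j (size l)) => [lt|le] /=; last first.
  split=> //; rewrite take_oversize ?(leqW le) // -(take_oversize le) E; congr Some.
  by apply/setP => f; rewrite !inE /= hx // ltnNge le.
(* Were this step not executable, the fold would stay at [None] on the rest of [l], against [El]. *)
have [st Est] : exists st, exec_act I (nth 0 l j) (state_of j x) = Some st.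
  move: El; rewrite -{1}(cat_take_drop j.+1 l) (take_nth 0 lt) /exec_seq foldl_cat.
  rewrite -/(exec_seq I (s0 I) (rcons (take j l) (nth 0 l j))) exec_seq_rcons E /=.
  case: exec_act => [st|] //=; first by exists st.
  by elim: (drop _ _).
have := Est; rewrite exec_act_state ?hl //; case: ifP => // ha _.
rewrite rA hl //=; split=> //.
rewrite (take_nth 0 lt) exec_seq_rcons E /= exec_act_state ?hl // ha; congr Some.
by apply/setP => f; rewrite !inE /= hx // lt.
Qed.

(** * Behaviour classes *)

Lemma similarP a b : a < size (acts I) -> b < size (acts I) ->
  reflect (same_effect I a b) (similar k W a b).
Proof.
move=> lta ltb; apply: (iffP (all_iotaP _ _)) => h.
  move=> s /code_of_state[d [hd hx]].
  (* Quotient 0 places the code below [base W ^ k], inside the range searched by [similar]. *)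
  have [|x [dx qx]] := @digits_exist W k d 0.
    by move=> i _; rewrite /base rA addn1 ltnS (leq_trans (hd i)) ?leq_addr.
  have [hv <-] := hx x dx.
  have ltx : x < base W ^ k by rewrite ltnNge -divn_gt0 ?expn_gt0 ?qx // /base addn1.
  have /implyP/(_ hv)/andP[/eqP Eap hst] := h x ltx.
  rewrite !exec_act_code // -Eap; case: ifP hst => //= _ /all_iotaP hst.
  by congr Some; apply/setP => f; rewrite !inE; apply/eqP/hst; rewrite rF.
move=> c _; apply/implyP => /valid_reachable/h; rewrite !exec_act_code //.
case: applies; case: applies => //= -[E]; apply/all_iotaP => f; rewrite rF => ltf.
by move/setP: E => /(_ (Ordinal ltf)); rewrite !inE /= => ->.
Qed.

Let leaders n := \sum_(0 <= b < n) leader k W b.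

Lemma leadersS n : leaders n.+1 = leaders n + leader k W n.
Proof. by rewrite /leaders big_nat_recr. Qed.

Lemma leaders_le m n : m <= n -> leaders m <= leaders n.
Proof.
elim: n => [|n IH]; first by rewrite leqn0 => /eqP->.
by rewrite leq_eqVlt => /predU1P[->//|/IH h]; rewrite leadersS (leq_trans h) ?leq_addr.
Qed.

Lemma same_effect_sym a b : same_effect I a b -> same_effect I b a.
Proof. by move=> h s hs; rewrite h. Qed.

Lemma same_effect_trans a b c : same_effect I a b -> same_effect I b c -> same_effect I a c.
Proof. by move=> h1 h2 s hs; rewrite h1 // h2. Qed.

(** Take for [r] the least action with the effect of [a]. The condition on [b] in [class] then
    amounts to [b < r], so the sum counts the leaders below [r]. *)
Lemma leader_of a : a < size (acts I) ->
  exists r, [/\ r < size (acts I), same_effect I r a, leader k W r & class k W a = leaders r].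
Proof.
move=> lta.
have ex : exists r, (r < size (acts I)) && similar k W r a.
  by exists a; rewrite lta; apply/similarP.
case: (ex_minnP ex) => r /andP[ltr /similarP hr] rmin.
have {}hr : same_effect I r a by apply: hr.
exists r; split=> //.
  apply/all_iotaP => c ltc; apply/negP => /similarP hc.
  have ltc' := ltn_trans ltc ltr.
  have : r <= c by apply: rmin; rewrite ltc'; apply/similarP => //; exact: same_effect_trans (hc _ _) hr.
  by rewrite leqNgt ltc.
rewrite /class rA /leaders (big_cat_nat (leq0n r) (ltnW ltr)) /=.
rewrite [X in _ + X]big_nat [X in _ + X]big1 => [|b /andP[le _]]; last first.
  apply/eqP; rewrite eqb0 negb_and; apply/orP; right; apply/negP => /all_iotaP /(_ r ltr).
  by rewrite ltnNge le implybF; case: similarP.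
rewrite addn0 big_nat [RHS]big_nat; apply: eq_bigr => b /andP[_ lt]; congr nat_of_bool.
case: leader => //=; apply/all_iotaP => c ltc; apply/implyP => hc.
by apply: leq_trans lt _; apply: rmin; rewrite ltc.
Qed.

(** The count [leaders] increases right after each leader, so two leaders of equal rank coincide. *)
Lemma class_inj a b : a < size (acts I) -> b < size (acts I) ->
  class k W a = class k W b -> same_effect I a b.
Proof.
move=> /leader_of[r [ltr hr lr ->]] /leader_of[r' [ltr' hr' lr' ->]] E.
suff e : r = r' by rewrite -e in hr'; exact: same_effect_trans (same_effect_sym hr) hr'.
case: (ltngtP r r') => // /leaders_le; rewrite leadersS ?lr ?lr' E; lia.
Qed.

(** A rank is below the number of leaders, and distinct leaders have distinct effects. *)
Lemma class_lt a : a < size (acts I) -> class k W a < k.+1 ^ k.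
Proof.
move=> lta; have [r [ltr hr lr ->]] := leader_of lta.
have : leaders r.+1 <= leaders (size (acts I)) by exact: leaders_le.
rewrite leadersS lr addn1 => h; apply: leq_trans h _.
have -> : leaders (size (acts I)) =
  size [seq b <- iota 0 (size (acts I)) | leader k W b].
  rewrite size_filter -sum1_count [RHS]big_mkcond /leaders /index_iota subn0.
  by apply: eq_bigr => b _; case: leader.
apply: (distinct_effects few_states).
- by rewrite filter_uniq ?iota_uniq.
- by apply/allP => b; rewrite mem_filter mem_iota => /andP[].
- move=> b c; rewrite !mem_filter !mem_iota /= !add0n => /andP[lb ltb] /andP[lc ltc] h.
  case: (ltngtP b c) => // lt.
    by have /all_iotaP/(_ _ lt)/negP[] := lc; apply/similarP.
  by have /all_iotaP/(_ _ lt)/negP[] := lb; apply/similarP => //; exact: same_effect_sym.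
Qed.

End Decode.

(** * Runs *)

Section Runs.
Variable I : htn_inst.
Hypothesis wf : wf_inst I.

Lemma alpha_lt (t : task I) : alpha I t < size (acts I).
Proof.
case: wf => _ [sz [/(all_nthP 0) h _]]; apply: h; rewrite sz; exact: ltn_ord.
Qed.

Lemma prec_irr (t : task I) : prec I t t = false.
Proof. by case: wf => _ [_ [_ [_ [h _]]]]; apply/negbTE/h. Qed.

Lemma prec_trans (t u v : task I) : prec I t u -> prec I u v -> prec I t v.
Proof. by case: wf => _ [_ [_ [_ [_ [h _]]]]]; apply: h. Qed.

(** Extending at the end matches the steps of the table, and asking that all predecessors have
    already occurred gives downward closure and order at once. *)
Inductive partial_run : seq (task I) -> state I -> Prop :=
| run_nil : partial_run [::] (s0 I)
| run_rcons s st t st' : partial_run s st -> t \notin s -> (forall u, prec I u t -> u \in s) ->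
    exec_act I (alpha I t) st = Some st' -> partial_run (rcons s t) st'.

Lemma run_exec s st : partial_run s st -> exec_seq I (s0 I) (map (@alpha I) s) = Some st.
Proof.
by elim=> // {}s {}st t st' _ E _ _ E'; rewrite map_rcons exec_seq_rcons E.
Qed.

Lemma run_uniq s st : partial_run s st -> uniq s.
Proof. by elim=> // {}s {}st t st' _ us ts _ _; rewrite rcons_uniq ts. Qed.

Lemma run_order s st : partial_run s st ->
  forall t u, u \in s -> prec I t u -> (t \in s) && (index t s < index u s).
Proof.
elim=> // {}s {}st v st' _ IH vs hv _ t u; rewrite !mem_rcons !inE -!cats1 !index_cat.
case: (eqVneq u v) => [->{u} _ /hv ht | _ /= us /(IH _ _ us)/andP[-> lt]].
  by rewrite ht orbT (negbTE vs) /= eqxx addn0 index_mem.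
by rewrite orbT us.
Qed.

Lemma run_reachable s st : partial_run s st -> reachable I st.
Proof.
move=> /run_exec E; exists (map (@alpha I) s); split=> //.
by apply/allP => _ /mapP[t _ ->]; exact: alpha_lt.
Qed.

Lemma run_intro s st : uniq s ->
  (forall t u, u \in s -> prec I t u -> (t \in s) && (index t s < index u s)) ->
  exec_seq I (s0 I) (map (@alpha I) s) = Some st -> partial_run s st.
Proof.
elim/last_ind: s st => [|s v IH] st; first by move=> _ _ [<-]; exact: run_nil.
rewrite rcons_uniq map_rcons exec_seq_rcons => /andP[vs us] h.
case E: exec_seq => [st'|] //= E'.
have hs t u : u \in s -> prec I t u -> (t \in s) && (index t s < index u s).
  move=> u_s tu; have := h t u; rewrite !mem_rcons !inE -!cats1 !index_cat u_s orbT.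
  move=> /(_ isT tu) /andP[_]; case: (boolP (t \in s)) => //= ts.
  by rewrite ltnNge ltnW // (leq_trans _ (leq_addr _ _)) // index_mem.
apply: run_rcons (IH _ us hs E) vs _ E' => u uv.
have := h u v; rewrite !mem_rcons !inE eqxx => /(_ isT uv)/andP[+ _].
by case: eqVneq => [e|//]; rewrite e prec_irr in uv.
Qed.

(** The order of a solution contains [prec], so its linearizations respect [prec]; conversely a run
    linearizes its own task set under [prec] itself. The parameter [Q] covers both problems. *)
Lemma solution_run (Q : seq (task I) -> state I -> Prop) :
  (exists (T' : {set task I}) (r : rel (task I)) (s : seq (task I)),
    [/\ sol_network I T' r, linearization I T' r s &
      exists st, exec_seq I (s0 I) (map (@alpha I) s) = Some st /\ Q s st]) <->
  exists s st, partial_run s st /\ Q s st.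
Proof.
split=> [[T' [r [s [[down _ ext] [us mem lin] [st [E q]]]]]]|[s [st [hrun q]]]].
  exists s, st; split=> //; apply: run_intro => // t u; rewrite !mem => uT tu.
  have tT := down _ _ uT tu; rewrite tT /=; apply: lin => //; exact: ext.
have ord := run_order hrun.
exists [set t in s], (@prec I), s; split; [split|split|].
- by move=> t u; rewrite !inE => us /(ord _ _ us)/andP[].
- split=> [t _|t u v _ _ _]; [by rewrite prec_irr | exact: prec_trans].
- by [].
- exact: run_uniq hrun.
- by move=> t; rewrite inE.
- by move=> t u _; rewrite inE => us /(ord _ _ us)/andP[].
- by exists st; rewrite (run_exec hrun).
Qed.

End Runs.

(** * Correctness of the table *)

Section Correctness.
Variables (k w : nat) (I : htn_inst) (W : world).
Let K := k.+1 ^ k.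
Hypothesis wf : wf_inst I.
Hypotheses (rF : n_prop W = nF I) (rA : n_act W = size (acts I)) (rT : n_task W = nT I).
Hypotheses
  (rpre : forall a f, a < size (acts I) -> in_pre W a f = (f \in (act_of I a).1.1))
  (rdel : forall a f, a < size (acts I) -> in_del W a f = (f \in (act_of I a).1.2))
  (radd : forall a f, a < size (acts I) -> in_add W a f = (f \in (act_of I a).2))
  (rinit : forall f, in_init W f = (f \in init I))
  (rlabel : forall t, t < nT I -> label W t = nth 0 (lab I) t)
  (rbefore : forall t u, before W t u = ((t, u) \in ord I)).
Hypotheses (few_states : nstates_le I k) (narrow : gpow_le I w).

Let cls (t : task I) := class k W (alpha I t).

Lemma label_alpha (t : task I) : label W t = alpha I t.
Proof. exact: rlabel. Qed.

Lemma before_prec (t u : task I) : before W t u = prec I t u.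
Proof. exact: rbefore. Qed.

Lemma lonelyP (t : task I) : reflect (isolated I t) (lonely W t).
Proof.
rewrite /lonely rT; apply: (iffP (all_iota_ordP _ _)) => h u.
  by move=> ne; have := h u; rewrite !before_prec val_eqE (negbTE ne).
by rewrite !before_prec val_eqE; case: eqVneq => //= /h.
Qed.

Lemma prec_linked (t u : task I) : prec I t u -> ~~ lonely W t /\ ~~ lonely W u.
Proof.
move=> tu; have ne : t != u by apply: contraTneq tu => ->; rewrite (prec_irr wf).
split; apply/negP => /lonelyP h.
  by move: (h u); rewrite eq_sym ne tu => /(_ isT).
by move: (h t); rewrite ne tu andbF => /(_ isT).
Qed.

Lemma executed_linked x (t : task I) : executed k w W x t -> ~~ lonely W t.
Proof. by rewrite /executed => /andP[]. Qed.

Definition class_count (s : seq (task I)) j := count (fun t : task I => lonely W t && (cls t == j)) s.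

Lemma count_card (s : seq (task I)) (p : pred (task I)) :
  uniq s -> count p s = #|[set t | (t \in s) && p t]|.
Proof.
move=> us; rewrite -size_filter -(card_uniqP (filter_uniq p us)).
by apply: eq_card => t; rewrite inE mem_filter andbC.
Qed.

Lemma sum_card (p : pred nat) :
  \sum_(0 <= t < n_task W) p t = #|[set t : task I | p t]|.
Proof.
rewrite rT big_mkord -sum1dep_card [RHS]big_mkcond.
by apply: eq_bigr => t _; case: p.
Qed.

Lemma class_sizeE j : class_size k W j = #|[set t : task I | lonely W t && (cls t == j)]|.
Proof. by rewrite /class_size sum_card; apply: eq_card => t; rewrite !inE label_alpha. Qed.

Definition abstracts (s : seq (task I)) (st : state I) x :=
  [/\ valid W k x, state_of I W k x = st,
      forall t : task I, executed k w W x t = (t \in s) && ~~ lonely W t,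
      forall j, j < K -> count_of k w W j x = class_count s j &
      time k w K W x = size s].

(* The executed non-isolated tasks form a down-set; its maximal elements are an
   antichain, so at most [w] of them generate it. *)
Lemma generators s st : partial_run s st ->
  exists d : nat -> nat, (forall i, d i <= nT I) /\
    forall x, (forall i, i < w -> digit W (k + i) x = d i) ->
      forall t : task I, executed k w W x t = (t \in s) && ~~ lonely W t.
Proof.
move=> hrun; have ord := run_order hrun.
pose D (t : task I) := (t \in s) && ~~ lonely W t.
pose A := [set t | D t && [forall u, D u ==> ~~ prec I t u]].
have szA : #|A| <= w.
  apply: narrow => [t|t u]; rewrite inE => /andP[/andP[_ ht] /forallP ht'].
    by move/lonelyP; exact/negP.
  by rewrite inE => /andP[hu _] _; have := ht' u; rewrite hu.
have maxA t : D t -> exists2 m, m \in A & (t == m) || prec I t m.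
  move=> ht; pose Q u := D u && ((u == t) || prec I t u).
  have Qt : Q t by rewrite /Q ht eqxx.
  (* The latest executed task at or above [t] is maximal, since anything executed above it would
     come later in the run. *)
  case: (arg_maxnP (index^~ s) Qt) => m /andP[hm tm] hmax.
  exists m; last by rewrite eq_sym.
  rewrite inE hm; apply/forallP => u; apply/implyP => hu; apply/negP => mu.
  have /hmax : Q u.
    rewrite /Q hu; apply/orP; right; case/predU1P: tm => [<- //|tm].
    exact: prec_trans tm mu.
  by case/andP: hu => us _; have /andP[_] := ord _ _ us mu; rewrite ltnNge => /negP.
exists (fun i => nth 0 [seq (val t).+1 | t <- enum A] i); split=> [i|x hx t].
  have [lt|le] := ltnP i (size (enum A)); last by rewrite nth_default // size_map.
  have : nth 0 [seq (val t).+1 | t <- enum A] i \in [seq (val t).+1 | t <- enum A].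
    by rewrite mem_nth // size_map.
  by case/mapP => t _ ->; exact: ltn_ord.
rewrite /executed andbC; have [_|linked] := boolP (lonely W t); first by rewrite !andbF.
rewrite !andbT; apply/hasP/idP => [[i]|ts].
  rewrite mem_iota => /andP[le lt].
  have lti : i - k < w by lia.
  have e := hx _ lti; rewrite subnKC // in e.
  rewrite {}e => /andP[nz].
  have szi : i - k < size [seq (val t).+1 | t <- enum A].
    by rewrite ltnNge; apply: contra nz => ?; rewrite nth_default.
  have /mapP[m] := mem_nth 0 szi; rewrite mem_enum inE => /andP[/andP[ms _] _] -> /=.
  rewrite before_prec val_eqE => /predU1P[<-//|tm].
  by have /andP[] := ord _ _ ms tm.
have [|m mA tm] := maxA t; first by rewrite /D ts.
have lti : index m (enum A) < #|A| by rewrite cardE index_mem mem_enum.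
exists (k + index m (enum A)).
  by rewrite mem_iota leq_addr ltn_add2l (leq_trans lti).
rewrite hx ?(leq_trans lti) // (nth_map m) ?index_mem ?mem_enum //.
rewrite nth_index ?mem_enum //= before_prec val_eqE eq_sym; exact: tm.
Qed.

Lemma class_count_le s st j : partial_run s st -> class_count s j <= nT I.
Proof.
move=> /run_uniq us; apply: leq_trans (count_size _ _) _.
by rewrite -(card_uniqP us) (leq_trans (max_card _)) // card_ord.
Qed.

(** All digits fit the base [n_act W + n_task W + 1]: actions are at most [n_act W], generators and
    counters at most [n_task W]. *)
Lemma code_exists s st : partial_run s st -> exists x, abstracts s st x.
Proof.
move=> hrun.
have [d1 [hd1 hx1]] := code_of_state rF rA rpre rdel radd rinit few_states (run_reachable wf hrun).
have [d2 [hd2 hx2]] := generators hrun.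
pose d i := if i < k then d1 i else if i < k + w then d2 (i - k) else class_count s (i - (k + w)).
have bE : base W = size (acts I) + nT I + 1 by rewrite /base rA rT.
have [|x [hx qx]] := @digits_exist W (k + w + K) d (size s).
  move=> i _; rewrite bE /d.
  by case: ifP => _; [have := hd1 i | case: ifP => _; [have := hd2 (i - k) |
    have := class_count_le (i - (k + w)) hrun]]; lia.
have [|hv hst] := hx1 x; first by move=> i lti; rewrite hx /d ?lti //; lia.
exists x; split=> //.
- apply: hx2 => i lti; rewrite hx /d; last by lia.
  by rewrite ltnNge leq_addr /= ltn_add2l lti addKn.
- move=> j ltj; rewrite /count_of hx /d; last by lia.
  rewrite ltnNge -addnA leq_addr /= addnA ltnNge leq_addr /=.
  by rewrite addKn.
Qed.

Variable T : nat -> nat.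
Let size_T := table_size k w K W.
Hypothesis T_rec : forall x, x < size_T -> (T x != 0) =
  valid W k x && (start k w K W x || has (fun y =>
    [&& T y != 0, (time k w K W y).+1 == time k w K W x & one_step k w K W y x]) (iota 0 x)).

Lemma base_gt0 : 0 < base W. Proof. by rewrite /base addn1. Qed.

Lemma time_lt y x : time k w K W y < time k w K W x -> y < x.
Proof. by rewrite /time => h; rewrite ltnNge; apply: contraL h => ?; rewrite -leqNgt leq_div2r. Qed.

Lemma abstracts_lt s st x : partial_run s st -> abstracts s st x -> x < size_T.
Proof.
move=> /run_uniq us [_ _ _ _ tx].
rewrite /size_T /table_size -ltn_divLR ?expn_gt0 ?base_gt0 // -/(time k w K W x) tx ltnS rT.
by rewrite -(card_uniqP us) (leq_trans (max_card _)) // card_ord.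
Qed.

(** Stated for every code of the run, not one chosen code. In the induction any code of the shorter
    run serves as predecessor, because steps look only at decoded data. *)
Lemma table_complete s st x : partial_run s st -> abstracts s st x -> T x != 0.
Proof.
move=> hrun hx; have ltx := abstracts_lt hrun hx.
rewrite T_rec //; elim: hrun x hx ltx => [|{}s {}st t st' hrun IH ts ht Et] x [-> sx ex cx tx] ltx.
  rewrite /= /start tx eqxx /=; apply/orP; left; apply/and3P; split.
  - rewrite rF; apply/all_iota_ordP => f; move/setP: sx => /(_ f).
    by rewrite !inE rinit => ->.
  - by rewrite rT; apply/all_iota_ordP => u; rewrite ex.
  - by apply/all_iotaP => j ltj; rewrite cx.
rewrite /=; apply/orP; right.
have [y hy] := code_exists hrun; have lty := abstracts_lt hrun hy.
have yx : y < x by apply: time_lt; rewrite tx size_rcons; case: hy => _ _ _ _ ->.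
apply/has_iotaP; exists y => //; rewrite T_rec // (IH y hy lty).
have [hv sy ey cy ty] := hy; rewrite tx ty size_rcons eqxx /=.
apply/has_iotaP; exists (val t); first by rewrite rT ltn_ord.
move: Et; rewrite -sy label_alpha (exec_act_code k rF rpre rdel radd _ (alpha_lt wf t)).
case: ifP => // _ [Est] /=; apply/andP; split.
  by apply/(state_eqP rF); rewrite sx -Est.
have [lt|lt] := boolP (lonely W t); last first.
  apply/orP; left; rewrite /linked_step lt ey (negbTE ts) /=; apply/and3P; split.
  - rewrite rT; apply/all_iota_ordP => u; apply/implyP; rewrite before_prec => ut.
    by rewrite ey (ht _ ut); have [-> _] := prec_linked ut.
  - apply/all_iotaP => j ltj; rewrite cx // cy // /class_count -cats1 count_cat /=.
    by rewrite (negbTE lt) /= ?addn0 eqxx.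
  - rewrite rT; apply/all_iota_ordP => u; rewrite ex ey mem_rcons inE val_eqE.
    by case: (eqVneq u t) => [->|_] /=; rewrite ?lt ?orbT ?orbF.
apply/orP; right; rewrite /lonely_step lt /=; apply/andP; split.
  apply/all_iotaP => j ltj; rewrite cx // cy // /class_count -cats1 count_cat /= lt label_alpha.
  rewrite addn0 eqxx /= class_sizeE.
  have -> : count (fun t : task I => lonely W t && (cls t == j)) s + (cls t == j) = class_count (rcons s t) j.
    by rewrite /class_count -cats1 count_cat /= lt addn0.
  rewrite /class_count count_card; last by rewrite rcons_uniq ts (run_uniq hrun).
  by apply/subset_leq_card/subsetP => u; rewrite !inE => /andP[].
rewrite rT; apply/all_iota_ordP => u; rewrite ex ey mem_rcons inE.
by case: (eqVneq u t) => [->|//]; rewrite lt !andbF.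
Qed.

(* Which tasks of a class have been executed does not matter: a code stands for
   runs executing any set of isolated tasks with the prescribed class counts. *)
Lemma table_sound x : x < size_T -> T x != 0 ->
  [/\ valid W k x, forall j, j < K -> count_of k w W j x <= class_size k W j &
   forall A : {set task I}, (forall t, t \in A -> lonely W t) ->
    (forall j, j < K -> #|[set t in A | cls t == j]| = count_of k w W j x) ->
    exists2 s, partial_run s (state_of I W k x) &
      forall t : task I, (t \in s) = executed k w W x t || (t \in A)].
Proof.
elim/ltn_ind: x => x IH ltx; rewrite T_rec // => /andP[hv].
case/orP => [/and4P[_ hs /all_iotaP he /all_iotaP hc]|/has_iotaP[y ltyx]].
  split=> // [j /hc /eqP -> //|A hA cA].
  exists [::] => [|t].
    suff -> : state_of I W k x = s0 I by exact: run_nil.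
    rewrite -(state_of0 rinit x); apply/(state_eqP rF); exact: hs.
  rewrite (negbTE (he t _)) ?rT //=; apply/esym/negP => tA.
  (* All counters are 0 at the start and every class is below [K], so the prescribed set [A] has no
     element [t]. *)
  have ltj : cls t < K by exact: (class_lt rF rA rpre rdel radd rinit few_states (alpha_lt wf t)).
  move: (cA _ ltj); rewrite (eqP (hc _ ltj)) => /eqP; rewrite cards_eq0 => /eqP/setP/(_ t).
  by rewrite !inE tA eqxx.
case/and3P=> Ty _ /has_iotaP[t0]; rewrite rT => ltt.
pose t : task I := Ordinal ltt; rewrite -[t0]/(val t) => /and3P[hap hst hstep].
have [hvy cy runy] := IH y ltyx (ltn_trans ltyx ltx) Ty.
rewrite label_alpha in hap hst.
have Et : exec_act I (alpha I t) (state_of I W k y) = Some (state_of I W k x).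
  rewrite (exec_act_code k rF rpre rdel radd _ (alpha_lt wf t)) hap; congr Some.
  by apply/esym/(state_eqP rF).
case/orP: hstep.
  case/and5P=> lt nt /all_iotaP ht /all_iotaP hc /all_iotaP he.
  have ec j : j < K -> count_of k w W j x = count_of k w W j y by move=> /hc/eqP.
  split=> // [j ltj|A hA cA]; first by rewrite ec // cy.
  have [|s hs ms] := runy A hA; first by move=> j ltj; rewrite cA ?ec.
  have ex (u : task I) : executed k w W x u = executed k w W y u || (u == t).
    by apply/eqP/he; rewrite rT ltn_ord.
  exists (rcons s t) => [|u].
    apply: run_rcons hs _ _ Et; first by rewrite ms (negbTE nt) /=; apply: contra lt => /hA.
    move=> u ut; rewrite ms; apply/orP; left.
    by have := ht u; rewrite rT ltn_ord before_prec ut; apply.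
  by rewrite mem_rcons inE ms ex orbCA orbA.
case/and3P=> lt /all_iotaP hc /all_iotaP he.
have ex (u : task I) : executed k w W x u = executed k w W y u.
  by apply/eqP/he; rewrite rT ltn_ord.
have ec j : j < K -> count_of k w W j x = count_of k w W j y + (cls t == j).
  by move=> /hc/andP[/eqP-> _]; rewrite label_alpha.
split=> // [j /hc/andP[] //|A hA cA].
have ltj : cls t < K by exact: (class_lt rF rA rpre rdel radd rinit few_states (alpha_lt wf t)).
(* The table entry was justified by [t], but the run is extended by some [u] in [A] of the same
   class. It exists as the counter is positive, it acts like [t] on the reachable state, and being
   isolated it has no predecessors. *)
have /card_gt0P[u] : 0 < #|[set u in A | cls u == cls t]|.
  by rewrite cA // ec // eqxx addn1.
rewrite inE => /andP[uA /eqP cu].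
have [|j lj|s hs ms] := runy (A :\ u).
- by move=> v /setD1P[_ /hA].
- have := cA j lj; rewrite ec // => e; apply: (@addIn (cls t == j)); rewrite -e.
  rewrite (cardsD1 u [set _ in A | _]) inE uA /= cu addnC; congr (_ + _).
  by apply: eq_card => v; rewrite !inE andbA.
exists (rcons s u) => [|v].
  have Eu : exec_act I (alpha I u) (state_of I W k y) = Some (state_of I W k x).
    rewrite -Et; apply: (class_inj rF rA rT rpre rdel radd rinit few_states) => //; try exact: alpha_lt.
    exact: valid_reachable hvy.
  apply: run_rcons hs _ _ Eu.
    rewrite ms !inE eqxx orbF; apply/negP => /executed_linked; by rewrite hA.
  by move=> v /prec_linked[_]; rewrite hA.
rewrite mem_rcons inE ms ex !inE.
by case: eqVneq => [->|_] //=; rewrite uA orbT.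
Qed.

(** In each class the members of [A0] are listed first and the first [c j] tasks are taken, which
    keeps [A0] and makes the counts exact. *)
Lemma fill_classes (c : nat -> nat) (A0 : {set task I}) :
  (forall j, j < K -> c j <= class_size k W j) -> (forall t, t \in A0 -> lonely W t) ->
  (forall j, j < K -> #|[set t in A0 | cls t == j]| <= c j) ->
  exists A : {set task I}, [/\ A0 \subset A, forall t, t \in A -> lonely W t &
    forall j, j < K -> #|[set t in A | cls t == j]| = c j].
Proof.
move=> hc hA0 cA0.
have cls_lt t : cls t < K by exact: (class_lt rF rA rpre rdel radd rinit few_states (alpha_lt wf t)).
pose in0 j := [set t in A0 | cls t == j].
pose out0 j := [set t : task I | lonely W t && (cls t == j)] :\: A0.
pose U j := enum (in0 j) ++ enum (out0 j).
have memU j t : (t \in U j) = lonely W t && (cls t == j).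
  rewrite mem_cat !mem_enum !inE; case: (boolP (t \in A0)) => //= tA.
  by rewrite (hA0 _ tA) orbF.
have uU j : uniq (U j).
  rewrite cat_uniq !enum_uniq andbT /=; apply/hasPn => t.
  by rewrite !mem_enum !inE => /andP[/negbTE ->].
have szU j : size (U j) = class_size k W j.
  by rewrite class_sizeE -(card_uniqP (uU j)); apply: eq_card => t; rewrite inE memU.
pose A := [set t | t \in take (c (cls t)) (U (cls t))].
exists A; split=> [|t|j ltj].
- apply/subsetP => t tA; rewrite inE take_cat -cardE.
  have t_in : t \in enum (in0 (cls t)) by rewrite mem_enum inE tA eqxx.
  case: ltnP => [lt|_]; last by rewrite mem_cat t_in.
  by have := cA0 _ (cls_lt t); rewrite leqNgt lt.
- by rewrite inE => /mem_take; rewrite memU => /andP[].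
have -> : c j = size (take (c j) (U j)) by rewrite size_takel // szU hc.
rewrite -(card_uniqP (take_uniq _ (uU j))); apply: eq_card => t; rewrite !inE.
have [->|ne] := eqVneq (cls t) j; first by rewrite andbT.
by rewrite andbF; apply/esym; apply: contraNF ne => /mem_take; rewrite memU => /andP[].
Qed.

Lemma reach_correct (G : seq nat) : (forall f, in_goal W f = (f \in G)) ->
  has (fun x => (T x != 0) && all (fun f => in_goal W f ==> holds W k x f) (iota 0 (n_prop W)))
    (iota 0 size_T) <-> StateReach I G.
Proof.
move=> rgoal; rewrite /StateReach.
rewrite (solution_run wf (fun _ st => Defs.set_of I G \subset st)); split.
  case/has_iotaP=> x ltx /andP[Tx]; rewrite rF => /all_iota_ordP hg.
  have [_ hcl hs] := table_sound ltx Tx.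
  have [||j|A [_ hA cA]] := @fill_classes (fun j => count_of k w W j x) set0 => //.
  - by move=> t; rewrite inE.
  - by rewrite (_ : [set _ in set0 | _] = set0) ?cards0 //; apply/setP => t; rewrite !inE.
  have [s hrun _] := hs A hA cA; exists s, (state_of I W k x); split=> //.
  by apply/subsetP => f; have := hg f; rewrite !inE rgoal => /implyP.
case=> s [st [hrun /subsetP hg]]; have [x hx] := code_exists hrun.
apply/has_iotaP; exists x; first exact: abstracts_lt hrun hx.
rewrite (table_complete hrun hx) rF /=; apply/all_iota_ordP => f; apply/implyP.
by rewrite rgoal; case: hx => _ sx _ _ _ fG; have := hg f; rewrite -sx !inE; apply.
Qed.

Let executed_as x a := [set t : task I | executed k w W x t & alpha I t == a].
Let lonely_as a := [set t : task I | lonely W t & alpha I t == a].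

Lemma needE (G : seq nat) x a : (forall a, goal_count W a = count_mem a G) ->
  need k w W x a = count_mem a G - #|executed_as x a|.
Proof.
move=> rcount; rewrite /need rcount sum_card; congr (_ - _).
by apply: eq_card => t; rewrite !inE label_alpha.
Qed.

Lemma lonely_asE a : \sum_(0 <= t < n_task W) (lonely W t && (label W t == a)) = #|lonely_as a|.
Proof. by rewrite sum_card; apply: eq_card => t; rewrite !inE label_alpha. Qed.

(** The class of a task depends only on its action, so a class count splits over actions and can be
    compared with a sum of needs. *)
Lemma class_partition (A : {set task I}) j :
  #|[set t in A | cls t == j]| =
  \sum_(0 <= a < n_act W) (class k W a == j) * #|[set t in A | alpha I t == a]|.
Proof.
rewrite rA big_mkord -sum1dep_card.
rewrite (partition_big (fun t => Ordinal (alpha_lt wf t)) xpredT) //=.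
apply: eq_bigr => a _.
have E t : [&& t \in A, cls t == j & Ordinal (alpha_lt wf t) == a] =
    (class k W a == j) && ((t \in A) && (alpha I t == a)).
  rewrite -val_eqE /=; case: (eqVneq (alpha I t) a) => [e|_]; last by rewrite !andbF.
  by rewrite !andbT andbC /cls e.
case: eqVneq E => [_ E|_ E]; last by rewrite big_pred0 // => t; rewrite -andbA E.
by rewrite mul1n -sum1dep_card; apply: eq_bigl => t; rewrite -andbA E.
Qed.

Lemma count_alpha (s : seq (task I)) x (A : {set task I}) a :
  uniq s -> (forall t : task I, (t \in s) = executed k w W x t || (t \in A)) ->
  (forall t, t \in A -> lonely W t) ->
  count_mem a (map (@alpha I) s) =
  #|executed_as x a| + #|[set t in A | alpha I t == a]|.
Proof.
move=> us hs hA; rewrite count_map count_card // -cardsUI.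
rewrite (_ : _ :&: _ = set0) ?cards0 ?addn0; last first.
  apply/setP => t; rewrite !inE; apply/negP => /andP[/andP[/executed_linked h _] /andP[/hA]].
  by rewrite (negbTE h).
by apply: eq_card => t; rewrite !inE hs -andb_orl.
Qed.

Lemma exec_correct (G : seq nat) :
  (forall a, goal_count W a = count_mem a G) -> all (fun a => a < size (acts I)) G ->
  has (fun x => [&& T x != 0,
    all (fun a => need k w W x a <= \sum_(0 <= t < n_task W) (lonely W t && (label W t == a)))
      (iota 0 (n_act W)) &
    all (fun j => \sum_(0 <= a < n_act W) (class k W a == j) * need k w W x a <=
      count_of k w W j x) (iota 0 K)]) (iota 0 size_T) <-> ActionExec I G.
Proof.
move=> rcount hG.
have -> : ActionExec I G <-> exists s st, partial_run s st /\
    forall a, count_mem a G <= count_mem a (map (@alpha I) s).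
  rewrite -(solution_run wf (fun s _ => forall a, count_mem a G <= count_mem a (map (@alpha I) s))).
  split=> -[T' [r [s]]].
    by case=> h1 h2 [st E] h3; exists T', r, s; split=> //; exists st.
  by case=> h1 h2 [st [E h3]]; exists T', r, s; split=> //; exists st.
split.
  case/has_iotaP=> x ltx /and3P[Tx]; rewrite rA => /all_iotaP hneed /all_iotaP hcls.
  have [_ hcl hs] := table_sound ltx Tx.
  (* For each action, the first [need] isolated tasks carrying it; [hneed] says that there are
     enough. *)
  pose A0 := [set t : task I |
    t \in take (need k w W x (alpha I t)) (enum (lonely_as (alpha I t)))].
  have hA0 t : t \in A0 -> lonely W t.
    by rewrite inE => /mem_take; rewrite mem_enum inE => /andP[].
  have cA0 a : a < size (acts I) -> #|[set t in A0 | alpha I t == a]| = need k w W x a.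
    move=> lta; have := hneed a lta; rewrite lonely_asE cardE => le.
    rewrite -(size_takel le) -(card_uniqP (take_uniq _ (enum_uniq _))).
    apply: eq_card => t; rewrite !inE; have [->|ne] := eqVneq (alpha I t) a; first by rewrite andbT.
    rewrite andbF; apply/esym; apply: contraNF ne => /mem_take.
    by rewrite mem_enum inE => /andP[].
  have [//|//|j ltj|A [A0A hA cA]] := @fill_classes (fun j => count_of k w W j x) A0.
    apply: leq_trans (hcls j ltj); rewrite class_partition rA.
    rewrite big_nat [X in _ <= X]big_nat; apply: leq_sum => a /andP[_ lta].
    by rewrite cA0.
  have [s hrun ms] := hs A hA cA; exists s, (state_of I W k x); split=> // a.
  rewrite (count_alpha _ (run_uniq hrun) ms hA).
  have [lta|gea] := ltnP a (size (acts I)); last first.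
    rewrite (count_memPn _) //; apply: contraL gea => aG.
    by rewrite -ltnNge; exact: (allP hG).
  have : #|[set t in A0 | alpha I t == a]| <= #|[set t in A | alpha I t == a]|.
    by apply/subset_leq_card/subsetP => t; rewrite !inE => /andP[tA ->]; rewrite (subsetP A0A) ?inE.
  by rewrite cA0 // (needE _ _ rcount); lia.
case=> s [st [hrun hG']]; have [x hx] := code_exists hrun.
apply/has_iotaP; exists x; first exact: abstracts_lt hrun hx.
rewrite (table_complete hrun hx) /=.
have [_ _ ex cx _] := hx; have us := run_uniq hrun.
(* Conversely, the isolated tasks of the run itself witness both conditions. *)
pose A := [set t : task I | (t \in s) && lonely W t].
have hA t : t \in A -> lonely W t by rewrite inE => /andP[].
have ms t : (t \in s) = executed k w W x t || (t \in A).
  by rewrite ex inE -andb_orr orNb andbT.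
have le a : need k w W x a <= #|[set t in A | alpha I t == a]|.
  by rewrite (needE _ _ rcount) leq_subLR -(count_alpha a us ms hA).
apply/andP; split.
  apply/all_iotaP => a _; rewrite lonely_asE; apply: leq_trans (le a) _.
  by apply/subset_leq_card/subsetP => t; rewrite !inE => /andP[/andP[_ ->]].
apply/all_iotaP => j ltj; rewrite cx // /class_count count_card //.
have -> : #|[set t | (t \in s) && (lonely W t && (cls t == j))]| = #|[set t in A | cls t == j]|.
  by apply: eq_card => t; rewrite !inE andbA.
rewrite class_partition; apply: leq_sum => a _; rewrite leq_mul2l le orbT //.
Qed.

End Correctness.

(** * From the table computed by the program to the decision problems *)

Lemma table_stable L In e m n y : y < m -> m <= n -> table L In e n y = table L In e m y.
Proof.
move=> ltm; elim: n => [|n IH]; first by rewrite leqn0 => /eqP <-.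
rewrite leq_eqVlt => /predU1P[->//|lt]; rewrite -IH //= upd_diff //.
by rewrite neq_ltn (leq_trans ltm).
Qed.

Lemma table_value L In e n y : y < n ->
  table L In e n y = (eval (World L In (table L In e y)) [:: y] e != 0).
Proof. by move=> lt; rewrite (@table_stable _ _ _ y.+1) //= upd_same. Qed.

Section Assembly.
Variables (k w : nat) (e : expr).
Let K := k.+1 ^ k.
Hypothesis eP : forall W env, eval W env e = entry k w K W (head 0 env).

(** An entry was computed from a partly filled table, but the recursion holds in the finished one:
    it consults only [y < x], and entries never change once written. *)
Lemma table_rec L In n x (W := World L In (fun _ => 0)) (T := table L In e n) : x < n ->
  (T x != 0) = valid W k x && (start k w K W x || has (fun y =>
    [&& T y != 0, (time k w K W y).+1 == time k w K W x & one_step k w K W y x]) (iota 0 x)).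
Proof.
move=> ltx; rewrite /T table_value // eP -/T.
(* Holds by conversion: apart from the lookup of predecessors, everything reads only the input, so
   the empty table of [W] may replace the current one. *)
have -> : entry k w K (World L In (table L In e x)) (head 0 [:: x]) =
  valid W k x && (start k w K W x || has (fun y => [&& table L In e x y != 0,
   (time k w K W y).+1 == time k w K W x & one_step k w K W y x]) (iota 0 x)) by [].
have -> : has (fun y => [&& table L In e x y != 0,
   (time k w K W y).+1 == time k w K W x & one_step k w K W y x]) (iota 0 x) =
  has (fun y => [&& T y != 0,
   (time k w K W y).+1 == time k w K W x & one_step k w K W y x]) (iota 0 x).
  apply: eq_in_has => y; rewrite mem_iota => lty.
  by rewrite /T (@table_stable _ _ _ x n) // ltnW.
by case: (_ && _).
Qed.

End Assembly.

Theorem theorem6 (k w : nat) :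
  (exists (P : program) (c d : nat),
     forall (I : htn_inst) (sg : seq nat),
       wf_inst I -> all (fun f => f < nF I) sg ->
       gpow_le I w -> nstates_le I k ->
       decides_within P c d (enc_SR I sg) (StateReach I sg))
  /\
  (exists (P : program) (c d : nat),
     forall (I : htn_inst) (S : seq nat),
       wf_inst I -> all (fun a => a < size (acts I)) S ->
       gpow_le I w -> nstates_le I k ->
       decides_within P c d (enc_AE I S) (ActionExec I S)).
Proof.
pose K := k.+1 ^ k.
(* The expressions are fixed by [k] and [w] before any instance is given, so one program and one
   polynomial serve all instances. *)
have [eS eSP] := computable_table_size k w K.
have [e1 e1P] := computable_entry k w K computable_head.
have [eR eRP] := computable_reach_answer k w K.
have [eA eAP] := computable_exec_answer k w K.
have boolP' (b : bool) : (nat_of_bool b != 0) <-> b by case: b.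
split.
  have [P [c [d [q HP]]]] := table_program eS e1 eR.
  exists P, c, d => I G wf _ narrow few.
  have [le [fuel [cost [E lec]]]] := HP (enc_SR I G) isT.
  set L := q * _ in le E; set In := nth 0 _ in E.
  pose W := World L In (fun _ => 0).
  have WI : wI W =1 nth 0 (enc_inst I ++ enc_list G) by [].
  exists fuel; do 2 eexists; split; [exact: E|split=> //].
  rewrite eSP eRP; apply: iff_trans (boolP' _) _.
  exact: (reach_correct wf (read_n_prop WI) (read_n_act WI) (read_n_task WI le)
    (read_pre WI le) (read_del WI le) (read_add WI le) (read_init WI le) (read_label wf WI le)
    (read_before WI le) few narrow (fun x => @table_rec k w e1 e1P L In _ x) (read_goal WI le)).
have [P [c [d [q HP]]]] := table_program eS e1 eA.
exists P, c, d => I G wf hG narrow few.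
have [le [fuel [cost [E lec]]]] := HP (enc_AE I G) isT.
set L := q * _ in le E; set In := nth 0 _ in E.
pose W := World L In (fun _ => 0).
have WI : wI W =1 nth 0 (enc_inst I ++ enc_list G) by [].
exists fuel; do 2 eexists; split; [exact: E|split=> //].
rewrite eSP eAP; apply: iff_trans (boolP' _) _.
exact: (exec_correct wf (read_n_prop WI) (read_n_act WI) (read_n_task WI le)
  (read_pre WI le) (read_del WI le) (read_add WI le) (read_init WI le) (read_label wf WI le)
  (read_before WI le) few narrow (fun x => @table_rec k w e1 e1P L In _ x) (read_goal_count WI le) hG).
Qed.
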